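(* Let $W=(W_i,w_i)_{i\in I}$ and $V=(V_i,v_i)_{i\in I}$ be fusion frames for a Hilbert space $\mathcal H$ and let $O\in\mathcal B(\mathcal H)$ have closed range. Then the following assertions hold. (1) If $\mathcal M^{(W,V)}(O)$ has closed range, then $$\left(\mathcal M^{(W,V)}(O)\right)^\dagger=\mathcal M^{(V,W)}\left(S_V^{-1}O^\dagger S_W^{-1}\right)$$ if and only if $S_V\mathsf R(O^* )=\mathsf R(O^* )$ and $S_W\mathsf R(O)=\mathsf R(O)$. (2) If $\mathcal M_\otimes^{(W,V)}(O)$ has closed range, then $$\left(\mathcal M_\otimes^{(W,V)}(O)\right)^\dagger=\mathcal M_\otimes^{(V,W)}(O^\dagger).$$
   Context: $\mathcal B(X,Y)$ denotes the bounded linear operators between Hilbert spaces; $\mathsf R(\cdot)$ and $\mathsf N(\cdot)$ denote range and null space; $\pi_U$ is the orthogonal projection onto a closed subspace $U$. For a bounded operator $U:\mathcal H_1\to\mathcal H_2$ with closed range, the pseudo-inverse $U^\dagger:\mathcal H_2\to\mathcal H_1$ is the unique bounded operator with $\mathsf R(U^\dagger)=\mathsf R(U^* )$, $\mathsf N(U^\dagger)=\mathsf N(U^* )$ and $UU^\dagger U=U$. A fusion frame for $\mathcal H$ is a family $W=(W_i,w_i)_{i\in I}$ of closed subspaces $W_i\subseteq\mathcal H$ and weights $w_i>0$ for which there are $0<A_W\le B_W<\infty$ with $A_W\|f\|^2\le\sum_iw_i^2\|\pi_{W_i}f\|^2\le B_W\|f\|^2$ for all $f\in\mathcal H$. $\left(\sum\bigoplus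 W_i\right)_{\ell^2}$ is the Hilbert space of $\{f_i\}_{i\in I}$ with $f_i\in W_i$, $\sum\|f_i\|^2<\infty$. Synthesis operator: $T_W\{f_i\}=\sum_iw_if_i$, with adjoint $T_W^*f=\{w_i\pi_{W_i}f\}_i$; fusion frame operator $S_W=T_WT_W^*$ (bounded, positive, invertible). For $O\in\mathcal B(\mathcal H)$, $\mathcal M^{(W,V)}(O)=T_W^*OT_V$ and $\mathcal M_\otimes^{(W,V)}(O)=T_W^*S_W^{-1/2}OS_V^{-1/2}T_V$, both operators from $\left(\sum\bigoplus V_i\right)_{\ell^2}$ to $\left(\sum\bigoplus W_i\right)_{\ell^2}$; $\mathcal M^{(V,W)}$ and $\mathcal M_\otimes^{(V,W)}$ are obtained by exchanging $W$ and $V$. *)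

(* Defs.v *)
From HB Require Import structures.
From mathcomp Require Import all_boot all_order all_algebra finmap complex.
From mathcomp Require Import boolp classical_sets functions cardinality fsbigop.
From mathcomp Require Import reals ereal topology normedtype sequences esum.
From mathcomp Require Import ring lra.
From mathcomp.analysis.showcase Require summability.

Set Implicit Arguments.
Unset Strict Implicit.
Unset Printing Implicit Defensive.
Import Order.TTheory GRing.Theory Num.Def Num.Theory.
Import numFieldNormedType.Exports.
Local Open Scope classical_set_scope.
Local Open Scope ring_scope.

(* Hilbert spaces are taken over either the real or the complex numbers. *)
Variant scalar_kind := RealScalars | ComplexScalars.

Definition scalar_field (R : realType) (F : scalar_kind) : numFieldType :=
  match F with RealScalars => R | ComplexScalars => R[i] end.

Section scalar_ops.
Context {R : realType} {F : scalar_kind}.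

Definition of_real : R -> scalar_field R F :=
  match F return R -> scalar_field R F with
  | RealScalars => id
  | ComplexScalars => real_complex R
  end.

Definition sre : scalar_field R F -> R :=
  match F return scalar_field R F -> R with
  | RealScalars => id
  | ComplexScalars => @complex.Re R
  end.

Definition sconj : scalar_field R F -> scalar_field R F :=
  match F return scalar_field R F -> scalar_field R F with
  | RealScalars => id
  | ComplexScalars => @conjc R
  end.

End scalar_ops.

Section scalar_theory.
Variables (R : realType) (F : scalar_kind).
Implicit Types (x y : scalar_field R F) (r s : R).

Lemma conj_is_zmod_morphism : zmod_morphism (@sconj R F).
Proof. by rewrite /sconj; case: F => // x y /=; rewrite rmorphB. Qed.

Lemma conj_is_monoid_morphism : monoid_morphism (@sconj R F).
Proof.
rewrite /sconj; case: F => //; split => [|x y]; first exact: rmorph1.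
exact: rmorphM.
Qed.

HB.instance Definition _ :=
  GRing.isZmodMorphism.Build (scalar_field R F) (scalar_field R F) (@sconj R F)
    conj_is_zmod_morphism.
HB.instance Definition _ :=
  GRing.isMonoidMorphism.Build (scalar_field R F) (scalar_field R F) (@sconj R F)
    conj_is_monoid_morphism.

Lemma of_real_is_zmod_morphism : zmod_morphism (@of_real R F).
Proof. by rewrite /of_real; case: F => // x y /=; rewrite rmorphB. Qed.

Lemma of_real_is_monoid_morphism : monoid_morphism (@of_real R F).
Proof.
rewrite /of_real; case: F => //; split => [|x y]; first exact: rmorph1.
exact: rmorphM.
Qed.

HB.instance Definition _ :=
  GRing.isZmodMorphism.Build R (scalar_field R F) (@of_real R F)
    of_real_is_zmod_morphism.
HB.instance Definition _ :=
  GRing.isMonoidMorphism.Build R (scalar_field R F) (@of_real R F)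
    of_real_is_monoid_morphism.

Lemma re_is_zmod_morphism : zmod_morphism (@sre R F).
Proof. by rewrite /sre; case: F => // -[a b] [c d]. Qed.

HB.instance Definition _ :=
  GRing.isZmodMorphism.Build (scalar_field R F) R (@sre R F) re_is_zmod_morphism.

Lemma sconjK : involutive (@sconj R F).
Proof. by rewrite /sconj; case: F => // x; rewrite conjcK. Qed.

Lemma re_conj x : sre (sconj x) = sre x.
Proof. by rewrite /sre /sconj; case: F x => // -[a b]. Qed.

Lemma re_of_real r : sre (of_real r : scalar_field R F) = r.
Proof. by rewrite /sre /of_real; case: F. Qed.

Lemma reM_of_real r x : sre (of_real r * x) = r * sre x.
Proof.
by rewrite /sre /of_real; case: F x => //= -[a b] /=; rewrite mul0r subr0.
Qed.

Lemma ler_of_real r s : (of_real r <= of_real s :> scalar_field R F) = (r <= s).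
Proof. by rewrite /of_real; case: F => //; rewrite lecR. Qed.

Lemma ler_re x y : x <= y -> sre x <= sre y.
Proof.
by rewrite /sre; case: F x y => //= x y; rewrite lecE => /andP[].
Qed.

Lemma of_realK x : 0 <= x -> of_real (sre x) = x.
Proof.
rewrite /sre /of_real; case: F x => //= x x0.
by rewrite RRe_real// ger0_real.
Qed.

Lemma mul_conj x : x * sconj x = `|x| ^+ 2.
Proof.
rewrite /sconj; case: F x => /= x; first by rewrite -expr2 real_normK ?num_real.
by rewrite normcE sqr_sqrtc.
Qed.

Lemma norm_conj x : `|sconj x| = `|x|.
Proof.
apply/eqP; rewrite -(@eqrXn2 _ 2)//.
by rewrite -!mul_conj sconjK mulrC.
Qed.

Lemma norm_of_real r : `|of_real r : scalar_field R F| = of_real `|r|.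
Proof.
rewrite /of_real; case: F => //.
by rewrite -[LHS]/(`|r%:C%C : R[i]|) normc_def /= expr0n addr0 sqrtr_sqr.
Qed.

Lemma re_le_norm x : sre x <= sre `|x|.
Proof.
rewrite /sre; case: F x => [x|x]; first exact: ler_norm.
rewrite [leRHS](_ : _ = complex.Re (`|x : R[i]|))// normc_def.
case: x => a b /=.
rewrite (le_trans (ler_norm _))// -sqrtr_sqr ler_sqrt ?addr_ge0 ?sqr_ge0//.
by rewrite lerDl sqr_ge0.
Qed.

End scalar_theory.

HB.mixin Record NormedModule_isInnerProduct (R : realType) (F : scalar_kind) H
    & NormedModule (scalar_field R F) H := {
  inner : {dot H for @sconj R F};
  sqr_normE : forall x : H, `|x| ^+ 2 = inner x x
}.

#[short(type="preHilbertType")]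
HB.structure Definition PreHilbert (R : realType) (F : scalar_kind) :=
  {H of NormedModule (scalar_field R F) H & NormedModule_isInnerProduct R F H}.

#[short(type="hilbertType")]
HB.structure Definition Hilbert (R : realType) (F : scalar_kind) :=
  {H of PreHilbert R F H & Complete H}.

Section rnorm.
Variables (R : realType) (F : scalar_kind) (V : normedModType (scalar_field R F)).
Implicit Types (x y : V).

(* The norm of a normed module over K is K-valued; [rnorm] is its value in R. *)
Definition rnorm x : R := sre `|x|.

Lemma of_rnorm x : of_real (rnorm x) = `|x|.
Proof. exact: of_realK. Qed.

Lemma rnorm_ge0 x : 0 <= rnorm x.
Proof. by rewrite -(raddf0 (@sre R F)) ler_re. Qed.

Lemma rnormD x y : rnorm (x + y) <= rnorm x + rnorm y.
Proof. by rewrite -raddfD ler_re// ler_normD. Qed.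

Lemma rnormZ a x : rnorm (a *: x) = sre `|a| * rnorm x.
Proof. by rewrite /rnorm normrZ -{1}(@of_realK _ _ `|a|)// reM_of_real. Qed.

Lemma rnormN x : rnorm (- x) = rnorm x.
Proof. by rewrite /rnorm normrN. Qed.

Lemma rnorm0 : rnorm (0 : V) = 0.
Proof. by rewrite /rnorm normr0 raddf0. Qed.

Lemma rnorm_le x y : (rnorm x <= rnorm y) = (`|x| <= `|y|).
Proof. by rewrite -!of_rnorm ler_of_real. Qed.

End rnorm.

Section dot_norm.
Variables (R : realType) (F : scalar_kind) (V : lmodType (scalar_field R F)).
Variable d : {dot V for @sconj R F}.
Implicit Types (x y : V).

Let dC x y : d x y = sconj (d y x).
Proof. by rewrite hermC expr0 mul1r. Qed.

Lemma dot_ge0 x : 0 <= d x x.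
Proof.
have [->|x0] := eqVneq x 0; first by rewrite linear0l.
by apply/ltW/neq0_dnorm_gt0.
Qed.

Definition dot_norm x : scalar_field R F := of_real (Num.sqrt (sre (d x x))).

Let re_dot_ge0 x : 0 <= sre (d x x).
Proof. by rewrite -(raddf0 (@sre R F)) ler_re// dot_ge0. Qed.

Lemma sqr_dot_norm x : dot_norm x ^+ 2 = d x x.
Proof. by rewrite /dot_norm -rmorphXn sqr_sqrtr//= of_realK// dot_ge0. Qed.

Lemma dot_norm_ge0 x : 0 <= dot_norm x.
Proof. by rewrite -(rmorph0 (@of_real R F)) ler_of_real sqrtr_ge0. Qed.

Lemma dot_CS x y : `|d x y| <= dot_norm x * dot_norm y.
Proof.
rewrite -(@ler_pXn2r _ 2) ?nnegrE ?mulr_ge0 ?dot_norm_ge0//.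
rewrite exprMn !sqr_dot_norm.
have [->|y0] := eqVneq y 0.
  by rewrite !linear0r normr0 expr0n /= mulr0.
have dy : 0 < d y y by apply: neq0_dnorm_gt0.
have dyn : d y y != 0 by rewrite gt_eqF.
have := dot_ge0 (x - (d x y / d y y) *: y).
set a := d x y / d y y.
have ay : a * d y y = d x y by rewrite /a divfK.
rewrite linearBr !linearBl /= !linearZl_LR !linearZr_LR /=.
rewrite [a * (_ * _)]mulrCA ay subrr subr0 subr_ge0 => h.
have e : a * d y x * d y y = `|d x y| ^+ 2.
  by rewrite -mul_conj mulrAC ay -dC.
by rewrite -e ler_wpM2r// ltW.
Qed.

Lemma ler_dot_normD x y : dot_norm (x + y) <= dot_norm x + dot_norm y.
Proof.
rewrite /dot_norm -rmorphD /= ler_of_real.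
rewrite -(@ler_pXn2r _ 2) ?nnegrE ?addr_ge0 ?sqrtr_ge0//.
rewrite sqrrD !sqr_sqrtr// linearDr !linearDl /= !raddfD /= (dC y x) re_conj.
rewrite [leLHS](_ : _ = sre (d x x) + sre (d x y) *+ 2 + sre (d y y)); last first.
  by rewrite mulr2n !addrA.
rewrite lerD2r lerD2l lerMn2r /=.
rewrite (le_trans (re_le_norm _))//.
have := ler_re (dot_CS x y).
by rewrite /dot_norm -rmorphM /= re_of_real.
Qed.

Lemma dot_normZ a x : dot_norm (a *: x) = `|a| * dot_norm x.
Proof.
apply/eqP; rewrite -(@eqrXn2 _ 2) ?mulr_ge0 ?dot_norm_ge0//.
rewrite exprMn !sqr_dot_norm linearZl_LR linearZr_LR /= mulrA.
by rewrite mul_conj.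
Qed.

Lemma dot_norm_eq0 x : dot_norm x = 0 -> x = 0.
Proof.
move=> x0; apply/eqP; apply/negPn/negP => xn0.
have : 0 < d x x by apply: neq0_dnorm_gt0.
by rewrite -sqr_dot_norm x0 expr0n ltxx.
Qed.

End dot_norm.

Section sums.
Variables (R : realType) (I : choiceType).
Implicit Types (a b : I -> R) (J : {fset I}).
Local Open Scope fset_scope.

Definition finite_total a := (\esum_(i in [set: I]) (a i)%:E < +oo)%E.
Definition total_sum a : R := fine (\esum_(i in [set: I]) (a i)%:E).

Lemma fsum_le_esum a J :
  ((\sum_(i <- J) a i)%:E <= \esum_(i in [set: I]) (a i)%:E)%E.
Proof.
apply: esum_ge; exists [set` J] => //.
by rewrite fsbig_finite//= set_fsetK sumEFin.
Qed.

Lemma esum_le_bound a (M : R) : (forall J, \sum_(i <- J) a i <= M) ->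
  (\esum_(i in [set: I]) (a i)%:E <= M%:E)%E.
Proof.
move=> aM; apply: ge_ereal_sup => _ [X [finX _] <-].
by rewrite fsbig_finite//= sumEFin lee_fin.
Qed.

Section nonneg.
Variable a : I -> R.
Hypotheses (a0 : forall i, 0 <= a i) (afin : finite_total a).

Lemma totalK : (\esum_(i in [set: I]) (a i)%:E = (total_sum a)%:E)%E.
Proof.
rewrite /total_sum fineK// ge0_fin_numE//.
by apply: esum_ge0 => i _; rewrite lee_fin.
Qed.

Lemma fsum_le_total J : \sum_(i <- J) a i <= total_sum a.
Proof. by rewrite -lee_fin -totalK fsum_le_esum. Qed.

Lemma total_ge0 : 0 <= total_sum a.
Proof. by have := fsum_le_total fset0; rewrite big_nil. Qed.

Lemma total_near (e : R) : 0 < e ->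
  exists A : {fset I}, total_sum a - e < \sum_(i <- A) a i.
Proof.
move=> e0; apply: contrapT => /forallNP h.
have /esum_le_bound : forall J, \sum_(i <- J) a i <= total_sum a - e.
  by move=> J; rewrite leNgt; apply/negP/h.
by rewrite totalK lee_fin lerBrDr gerDl leNgt e0.
Qed.

Lemma tail_near (e : R) : 0 < e ->
  exists A : {fset I}, forall J, A `<=` J -> \sum_(i <- J `\` A) a i <= e.
Proof.
move=> /total_near[A hA]; exists A => J AJ.
have := fsum_le_total J; rewrite [X in X <= _](big_fsetID _ (mem A))/=.
rewrite (_ : [fset x | x in J & x \in A] = A); last first.
  apply/fsetP => x; rewrite !inE/=.
  by have [/(fsubsetP AJ)->|_] := boolP (x \in A); rewrite ?andbF.
rewrite (_ : [fset x | x in J & x \notin A] = J `\` A); last first.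
  by apply/fsetP => x; rewrite !inE/= andbC.
move=> h; rewrite -(lerD2l (\sum_(i <- A) a i)) (le_trans h)//.
by rewrite -lerBlDr ltW.
Qed.

End nonneg.

Lemma finite_total_le a b : (forall i, a i <= b i) ->
  finite_total b -> finite_total a.
Proof. by move=> ab; apply: le_lt_trans; apply: le_esum => i _; rewrite lee_fin. Qed.

Lemma finite_totalD a b : (forall i, 0 <= a i) -> (forall i, 0 <= b i) ->
  finite_total a -> finite_total b -> finite_total (fun i => (a i + b i)%R).
Proof.
move=> a0 b0 fa fb; rewrite /finite_total.
under eq_esum do rewrite EFinD.
by rewrite esumD ?lte_add_pinfty// => i _; rewrite lee_fin.
Qed.

Lemma finite_totalZ a (k : R) : 0 <= k -> (forall i, 0 <= a i) ->
  finite_total a -> finite_total (fun i => k * a i).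
Proof.
move=> k0 a0 fa.
have : (\esum_(i in [set: I]) (k * a i)%:E <= (k * total_sum a)%:E)%E.
  by apply: esum_le_bound => J; rewrite -mulr_sumr ler_wpM2l// fsum_le_total.
by move/le_lt_trans; apply; rewrite ltry.
Qed.

End sums.

Lemma partial_sumE (I : choiceType) (V : zmodType) (x : I -> V) (J : {fset I}) :
  summability.partial_sum x J = \sum_(i <- J) x i.
Proof. by rewrite /summability.partial_sum big_seq_fsetE. Qed.

Lemma near_totally (I : choiceType) (P : set {fset I}) (A : {fset I}) :
  (forall J, (A `<=` J)%fset -> P J) -> \forall J \near summability.totally, P J.
Proof. by move=> h; exists A. Qed.


#[global] Existing Instance summability.totally_filter.

Section scalar_complete.
Variable R : realType.

Lemma ltr_of_real F (r s : R) : (of_real r < of_real s :> scalar_field R F) = (r < s).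
Proof. by rewrite !lt_neqAle ler_of_real fmorph_eq. Qed.

Lemma gt0_of_realK F (e : scalar_field R F) : 0 < e -> exists2 r : R, 0 < r & e = of_real r.
Proof.
move=> e0; have er := of_realK (ltW e0); exists (sre e) => //.
by rewrite -(@ltr_of_real F) er rmorph0.
Qed.

Lemma cauchy_coordinate F (p : scalar_field R F -> R) (G : set_system (scalar_field R F)) :
  (forall x y, `|p x - p y| <= sre `|x - y|) ->
  ProperFilter G -> cauchy G -> cvg (p @ G).
Proof.
move=> hp FG /cauchyP cG; apply: R_complete; apply: cauchy_exP => e e0.
have e0' : 0 < of_real e :> scalar_field R F by rewrite -(rmorph0 of_real) ltr_of_real.
have [z Gz] := cG _ e0'; exists (p z).
suff : G (p @^-1` ball (p z) e) by [].
apply: filterS Gz => y; rewrite -ball_normE /= => yz.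
rewrite /ball /= (le_lt_trans (hp z y))//.
by rewrite -(@ltr_of_real F) of_realK.
Qed.

Lemma scalar_cauchy_cvg F (G : set_system (scalar_field R F)) :
  ProperFilter G -> cauchy G -> cvg G.
Proof.
case: F G => [|] G FG cG; first exact: R_complete.
have hre : cvg ((@complex.Re R : scalar_field R ComplexScalars -> R) @ G).
  apply: cauchy_coordinate cG => x y.
  rewrite -raddfB; apply: le_trans (_ : sre `|of_real `|complex.Re (x - y)| : scalar_field R ComplexScalars| <= _).
    by rewrite norm_of_real re_of_real normr_id.
  apply: ler_re; rewrite norm_of_real normr_id.
  rewrite [leRHS](_ : _ = `|(x : R[i]) - y|)// normc_def.
  rewrite lecR -sqrtr_sqr ler_sqrt ?addr_ge0 ?sqr_ge0//.
  by rewrite lerDl sqr_ge0.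
have him : cvg ((@complex.Im R : scalar_field R ComplexScalars -> R) @ G).
  apply: cauchy_coordinate cG => x y.
  rewrite -raddfB; apply: le_trans (_ : sre `|of_real `|complex.Im (x - y)| : scalar_field R ComplexScalars| <= _).
    by rewrite norm_of_real re_of_real normr_id.
  apply: ler_re; rewrite norm_of_real normr_id.
  rewrite [leRHS](_ : _ = `|(x : R[i]) - y|)// normc_def.
  rewrite lecR -sqrtr_sqr ler_sqrt ?addr_ge0 ?sqr_ge0//.
  by rewrite lerDr sqr_ge0.
have /cvg_ex[a ha] := hre; have /cvg_ex[b hb] := him.
apply/cvg_ex; exists ((a +i* b)%C : scalar_field R ComplexScalars).
apply/cvg_ballP => e /gt0_of_realK[r r0 ->].
have r2 : 0 < r / 2 by rewrite divr_gt0.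
have hA : G [set z : R[i] | `|a - complex.Re z| < r / 2].
  by move/cvgrPdist_lt : ha => /(_ _ r2).
have hB : G [set z : R[i] | `|b - complex.Im z| < r / 2].
  by move/cvgrPdist_lt : hb => /(_ _ r2).
apply: filterS2 hA hB => z /= hA hB; rewrite -ball_normE /=.
rewrite [ltLHS](_ : _ = `|(a +i* b)%C - (z : R[i])|)// normc_def.
rewrite ltcR (splitr r) (le_lt_trans _ (ltrD hA hB))//.
case: z {hA hB} => c d /=.
rewrite -[leRHS]ger0_norm ?addr_ge0// -sqrtr_sqr ler_sqrt ?sqr_ge0//.
have sqD (u v : R) : u ^+ 2 + v ^+ 2 <= (`|u| + `|v|) ^+ 2.
  rewrite sqrrD !real_normK ?num_real// addrAC lerDl.
  by rewrite mulrn_wge0// mulr_ge0.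
exact: sqD.
Qed.

End scalar_complete.

Section absolute_convergence.
Variables (R : realType) (F : scalar_kind) (I : choiceType).

Lemma rnorm_sum (V : normedModType (scalar_field R F)) (x : I -> V) (s : seq I) :
  rnorm (\sum_(i <- s) x i) <= \sum_(i <- s) rnorm (x i).
Proof.
elim: s => [|i s IH]; first by rewrite !big_nil rnorm0.
by rewrite !big_cons (le_trans (rnormD _ _))// lerD2l.
Qed.

Lemma partial_sum_cauchy (V : normedModType (scalar_field R F)) (x : I -> V) :
  finite_total (fun i => rnorm (x i)) ->
  cauchy (summability.partial_sum x @ summability.totally).
Proof.
move=> fx; apply: cauchy_exP => e /gt0_of_realK[r r0 ->].
have [A hA] := tail_near (fun i => rnorm_ge0 (x i)) fx (divr_gt0 r0 (ltr0n _ 2)).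
exists (\sum_(i <- A) x i).
apply: (@near_totally _ _ A) => J AJ /=.
rewrite partial_sumE -ball_normE /= -of_rnorm ltr_of_real.
rewrite -[X in _ - X](_ : \sum_(i <- A) x i + \sum_(i <- (J `\` A)%fset) x i = _).
  rewrite opprD addNKr rnormN (le_lt_trans (rnorm_sum _ _))//.
  rewrite (le_lt_trans (hA _ AJ))// ltr_pdivrMr// ltr_pMr// ltr1n//.
rewrite [RHS](big_fsetID _ (mem A))/=; congr (_ + _); apply: eq_fbigl => i.
  rewrite !inE/=.
  by have [/(fsubsetP AJ)->|_] := boolP (i \in A); rewrite ?andbF.
by rewrite !inE/= andbC.
Qed.

Lemma scalar_sum_cvg (x : I -> scalar_field R F) :
  finite_total (fun i => rnorm (x i)) ->
  cvg (summability.partial_sum x @ summability.totally).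
Proof.
move=> fx; apply: scalar_cauchy_cvg; exact: partial_sum_cauchy.
Qed.

Lemma real_sum_cvg (a : I -> R) : (forall i, 0 <= a i) -> finite_total a ->
  summability.partial_sum (fun i => of_real (a i) : scalar_field R F)
    @ summability.totally --> (of_real (total_sum a) : scalar_field R F).
Proof.
move=> a0 fa; apply/cvgrPdist_lt => e /gt0_of_realK[r r0 ->].
have [A hA] := total_near a0 fa r0.
apply: (@near_totally _ _ A) => J AJ /=.
rewrite partial_sumE -rmorph_sum -rmorphB /= norm_of_real ltr_of_real.
rewrite ger0_norm ?subr_ge0 ?fsum_le_total//.
rewrite ltrBlDr -ltrBlDl (lt_le_trans hA)//.
rewrite [leRHS](big_fsetID _ (mem A))/=.
rewrite (_ : [fset x | x in J & x \in A]%fset = A); last first.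
  apply/fsetP => x; rewrite !inE/=.
  by have [/(fsubsetP AJ)->|_] := boolP (x \in A); rewrite ?andbF.
by rewrite lerDl sumr_ge0.
Qed.

End absolute_convergence.

Record closed_subspace (R : realType) (F : scalar_kind) (H : hilbertType R F) :=
  ClosedSubspace {
    subspace_set :> set H;
    subspace0 : subspace_set 0;
    subspaceP : forall (a : scalar_field R F) (x y : H),
      subspace_set x -> subspace_set y -> subspace_set (a *: x + y);
    subspace_closed : closed subspace_set
  }.

Definition square_summable (R : realType) (F : scalar_kind) (H : hilbertType R F)
    (I : choiceType) (f : I -> H) : Prop :=
  finite_total (fun i => rnorm (f i) ^+ 2).

Section square_summable_theory.
Variables (R : realType) (F : scalar_kind) (H : hilbertType R F).
Variables (I : choiceType).
Implicit Types f g : I -> H.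

Let sq_ge0 f i : 0 <= rnorm (f i) ^+ 2. Proof. exact: sqr_ge0. Qed.

Lemma square_summable0 : square_summable (fun _ : I => 0 : H).
Proof.
rewrite /square_summable /finite_total esum1 ?ltry// => i _.
by rewrite rnorm0 expr0n.
Qed.

Lemma square_summableD f g : square_summable f -> square_summable g ->
  square_summable (fun i => f i + g i).
Proof.
move=> hf hg.
apply: (@finite_total_le _ _ _
  (fun i => 2 * rnorm (f i) ^+ 2 + 2 * rnorm (g i) ^+ 2)); last first.
  by apply: finite_totalD => [i|i||]; [rewrite mulr_ge0|rewrite mulr_ge0|
    exact: finite_totalZ|exact: finite_totalZ].
move=> i; apply: (@le_trans _ _ ((rnorm (f i) + rnorm (g i)) ^+ 2)).
  by rewrite lerXn2r ?nnegrE ?addr_ge0 ?rnorm_ge0 ?rnormD.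
rewrite -subr_ge0.
rewrite (_ : _ - _ = (rnorm (f i) - rnorm (g i)) ^+ 2) ?sqr_ge0//.
by rewrite sqrrD sqrrB !mulr_natl !mulr2n; ring.
Qed.

Lemma square_summableZ a f : square_summable f ->
  square_summable (fun i => a *: f i).
Proof.
move=> hf; apply: (@finite_total_le _ _ _
  (fun i => sre `|a| ^+ 2 * rnorm (f i) ^+ 2)).
  by move=> i; rewrite rnormZ exprMn.
by apply: finite_totalZ => //; exact: sqr_ge0.
Qed.

Lemma norm_inner (x y : H) : sre `|inner x y| <= rnorm x * rnorm y.
Proof.
have dE (z : H) : dot_norm (inner : {dot H for sconj}) z = `|z|.
  apply/eqP; rewrite -(@eqrXn2 _ 2) ?dot_norm_ge0//.
  by rewrite sqr_dot_norm sqr_normE.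
have := ler_re (dot_CS inner x y).
by rewrite !dE -(of_rnorm x) -(of_rnorm y) -rmorphM /= re_of_real.
Qed.

Lemma inner_summable f g : square_summable f -> square_summable g ->
  finite_total (fun i => rnorm (inner (f i) (g i) : scalar_field R F)).
Proof.
move=> hf hg; apply: (@finite_total_le _ _ _
  (fun i => rnorm (f i) ^+ 2 + rnorm (g i) ^+ 2)); last exact: finite_totalD.
move=> i; rewrite (le_trans (norm_inner _ _))//.
set u := rnorm (f i); set v := rnorm (g i).
have : 0 <= (u - v) ^+ 2 + u ^+ 2 + v ^+ 2 by rewrite !addr_ge0 ?sqr_ge0.
by rewrite sqrrB => h; lra.
Qed.

Lemma inner_sum_cvg f g : square_summable f -> square_summable g ->
  cvg (summability.partial_sum (fun i => inner (f i) (g i) : scalar_field R F)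
    @ summability.totally).
Proof. by move=> hf hg; exact/scalar_sum_cvg/inner_summable. Qed.

End square_summable_theory.

Section l2sum.
Variables (R : realType) (F : scalar_kind) (H : hilbertType R F).
Variables (I : choiceType) (W : I -> closed_subspace H).

Definition in_l2sum : pred (I -> H) :=
  fun f => `[< (forall i, subspace_set (W i) (f i)) /\ square_summable f >].

(* Elements of the l^2 direct sum of the subspaces W i. *)
Record l2sum := L2Sum { l2sum_fun :> I -> H; l2sumP : in_l2sum l2sum_fun }.

HB.instance Definition _ := [isSub for l2sum_fun].
HB.instance Definition _ := [Choice of l2sum by <:].

Lemma in_l2sum_submod_closed : GRing.submod_closed in_l2sum.
Proof.
split.
  by apply/asboolP; split=> [i|]; [exact: subspace0|exact: square_summable0].
move=> a f g /asboolP[fW fs] /asboolP[gW gs]; apply/asboolP; split=> [i|].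
  exact: subspaceP.
by apply: square_summableD => //; exact: square_summableZ.
Qed.

HB.instance Definition _ :=
  GRing.isSubmodClosed.Build (scalar_field R F) (I -> H) in_l2sum
    in_l2sum_submod_closed.
HB.instance Definition _ := [SubChoice_isSubLmodule of l2sum by <:].

Implicit Types f g : l2sum.

Lemma l2sum_in f i : subspace_set (W i) (f i).
Proof. by have /asboolP[] := l2sumP f. Qed.

Lemma l2sum_square_summable f : square_summable f.
Proof. by have /asboolP[] := l2sumP f. Qed.

Definition l2_inner f g : scalar_field R F :=
  summability.sum (fun i => inner (f i) (g i) : scalar_field R F).

Lemma l2_inner_cvg f g :
  summability.partial_sum (fun i => inner (f i) (g i) : scalar_field R F)
    @ summability.totally --> l2_inner f g.
Proof. by apply: inner_sum_cvg; exact: l2sum_square_summable. Qed.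

Lemma l2_inner_eq f g (l : scalar_field R F) :
  summability.partial_sum (fun i => inner (f i) (g i) : scalar_field R F)
    @ summability.totally --> l -> l2_inner f g = l.
Proof. by move=> h; exact: norm_cvg_unique (@l2_inner_cvg f g) h. Qed.

Lemma l2_inner_linearl g : linear_for *%R (l2_inner^~ g).
Proof.
move=> a f h; apply: l2_inner_eq.
rewrite (_ : summability.partial_sum _ = fun J =>
    a * summability.partial_sum (fun i => inner (f i) (g i) : scalar_field R F) J +
    summability.partial_sum (fun i => inner (h i) (g i) : scalar_field R F) J).
  by apply: cvgD; [apply: cvgMr|]; exact: l2_inner_cvg.
apply/funext => J; rewrite !partial_sumE mulr_sumr -big_split/=.
by apply: eq_bigr => i _; rewrite linearDl linearZl_LR.
Qed.

Lemma l2_innerC f g : l2_inner f g = sconj (l2_inner g f).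
Proof.
apply: l2_inner_eq; apply/cvgrPdist_lt => e e0.
have /cvgrPdist_lt/(_ _ e0) := @l2_inner_cvg g f.
apply: filterS => J; rewrite -norm_conj rmorphB/=; congr (`|_ - _| < _).
rewrite !partial_sumE rmorph_sum; apply: eq_bigr => i _ /=.
by rewrite [RHS]hermC expr0 mul1r.
Qed.

Lemma l2_innerE f : l2_inner f f = of_real (total_sum (fun i => rnorm (f i) ^+ 2)).
Proof.
apply: l2_inner_eq.
rewrite (_ : (fun i => inner (f i) (f i)) = fun i => of_real (rnorm (f i) ^+ 2)).
  apply: real_sum_cvg; last exact: l2sum_square_summable.
  by move=> i; exact: sqr_ge0.
by apply/funext => i; rewrite -sqr_normE rmorphXn/= of_rnorm.
Qed.

Lemma l2sum_coord_le f i :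
  rnorm (f i) ^+ 2 <= total_sum (fun i => rnorm (f i) ^+ 2).
Proof.
have := fsum_le_total (fun i => sqr_ge0 (rnorm (f i))) (l2sum_square_summable f).
by move=> /(_ [fset i]%fset); rewrite big_seq_fset1.
Qed.

Lemma l2_inner_gt0 f : f != 0 -> 0 < l2_inner f f.
Proof.
move=> f0; rewrite l2_innerE -(rmorph0 of_real) ltr_of_real lt_neqAle.
rewrite total_ge0 ?andbT//; last 2 first.
- by move=> i; exact: sqr_ge0.
- exact: l2sum_square_summable.
apply: contra f0 => /eqP t0; apply/eqP/val_inj/funext => i /=.
have := l2sum_coord_le f i; rewrite -t0 => fi.
apply/eqP; rewrite -normr_eq0 -of_rnorm fmorph_eq0.
by rewrite -sqrf_eq0 eq_le fi sqr_ge0.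
Qed.

Lemma l2_inner_bilinear : bilinear_for *%R (sconj \; *%R) l2_inner.
Proof.
split=> [g|f] a x y; first exact: l2_inner_linearl.
by rewrite l2_innerC l2_inner_linearl rmorphD rmorphM /= -!l2_innerC.
Qed.

HB.instance Definition _ := bilinear_isBilinear.Build (scalar_field R F) l2sum l2sum
  (scalar_field R F) *%R (sconj \; *%R) l2_inner l2_inner_bilinear.

Lemma l2_inner_hermitian f g : l2_inner f g = (-1) ^+ false * sconj (l2_inner g f).
Proof. by rewrite expr0 mul1r l2_innerC. Qed.

HB.instance Definition _ := isHermitianSesquilinear.Build (scalar_field R F) l2sum
  false sconj l2_inner l2_inner_hermitian.
HB.instance Definition _ := isDotProduct.Build (scalar_field R F) l2sum l2_inner
  l2_inner_gt0.

HB.instance Definition _ := Lmodule_isNormed.Build (scalar_field R F) l2sum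
  (@ler_dot_normD R F l2sum l2_inner) (@dot_normZ R F l2sum l2_inner)
  (@dot_norm_eq0 R F l2sum l2_inner).

HB.instance Definition _ := NormedModule_isInnerProduct.Build R F l2sum
  (@sqr_dot_norm R F l2sum l2_inner).

End l2sum.

Section l2sum_complete.
Variables (R : realType) (F : scalar_kind) (H : hilbertType R F).
Variables (I : choiceType) (W : I -> closed_subspace H).
Implicit Types f g p : l2sum W.

Lemma sqr_rnorm_l2sum f : rnorm f ^+ 2 = total_sum (fun i => rnorm (f i) ^+ 2).
Proof.
apply: (fmorph_inj (@of_real R F)).
by rewrite rmorphXn/= of_rnorm sqr_normE -l2_innerE.
Qed.

Lemma rnorm_dist (V : normedModType (scalar_field R F)) (x y : V) :
  `|rnorm x - rnorm y| <= rnorm (x - y).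
Proof.
rewrite ler_norml; apply/andP; split.
  by rewrite lerNl opprB lerBlDr -(rnormN (x - y)) opprB -{1}(subrK x y) rnormD.
by rewrite lerBlDr -{1}(subrK y x) rnormD.
Qed.

Lemma rnorm_cvg (T : Type) (G : set_system T) (V : normedModType (scalar_field R F))
    (u : T -> V) (l : V) : Filter G ->
  u @ G --> l -> (fun t => rnorm (u t)) @ G --> rnorm l.
Proof.
move=> FG /cvgrPdist_lt ul; apply/cvgrPdist_lt => e e0.
have e0' : 0 < of_real e :> scalar_field R F by rewrite -(rmorph0 of_real) ltr_of_real.
apply: filterS (ul _ e0') => t; rewrite -of_rnorm ltr_of_real.
by apply: le_lt_trans; exact: rnorm_dist.
Qed.

Lemma l2sum_coord_rnorm f i : rnorm (f i) <= rnorm f.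
Proof.
rewrite -(@ler_pXn2r _ 2) ?nnegrE ?rnorm_ge0//.
by rewrite sqr_rnorm_l2sum l2sum_coord_le.
Qed.

Lemma l2sumB f p i : (f - p) i = f i - p i.
Proof. by []. Qed.

Lemma l2sum_cauchy_cvg (G : set_system (l2sum W)) :
  ProperFilter G -> cauchy G -> cvg G.
Proof.
move=> FG /cauchyP cG.
have cG' (e : R) : 0 < e -> exists p, G [set f | rnorm (p - f) < e].
  move=> e0.
  have e0' : 0 < of_real e :> scalar_field R F by rewrite -(rmorph0 of_real) ltr_of_real.
  have [p Gp] := cG _ e0'; exists p; apply: filterS Gp => f.
  by rewrite -ball_normE /= -of_rnorm ltr_of_real.
have gcvg i : cvg ((fun f : l2sum W => f i) @ G).
  apply: cauchy_cvg; apply: cauchy_exP => e /gt0_of_realK[r r0 ->].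
  have [p Gp] := cG' _ r0; exists (p i).
  suff : G ((fun f : l2sum W => f i) @^-1` ball (p i) (of_real r)) by [].
  apply: filterS Gp => f /= pf; rewrite -ball_normE /= -of_rnorm ltr_of_real.
  by apply: le_lt_trans pf; exact: (@l2sum_coord_rnorm (p - f)).
pose g i := lim ((fun f : l2sum W => f i) @ G).
have gP i : (fun f : l2sum W => f i) @ G --> g i by exact: gcvg.
have gW i : subspace_set (W i) (g i).
  apply: (@closed_cvg (l2sum W) H G FG (fun f => f i) _ (@subspace_closed _ _ _ (W i)) _ _ (gP i)).
  by apply: nearW => f; exact: l2sum_in.
have close (e : R) p : 0 < e -> G [set f | rnorm (p - f) < e] ->
    forall J : {fset I}, \sum_(i <- J) rnorm (p i - g i) ^+ 2 <= e ^+ 2.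
  move=> e0 Gp J.
  have lim_sum : (fun f : l2sum W => \sum_(i <- J) rnorm (p i - f i) ^+ 2) @ G
      --> \sum_(i <- J) rnorm (p i - g i) ^+ 2.
    elim: (J : seq I) => [|i s IH].
      by under eq_fun do rewrite big_nil; rewrite big_nil; exact: cvg_cst.
    under eq_fun do rewrite big_cons; rewrite big_cons; apply: cvgD => //.
    under eq_fun do rewrite expr2; rewrite expr2.
    by apply: cvgM; apply: rnorm_cvg; apply: cvgB (gP i); exact: cvg_cst.
  apply: (cvgr_to_le lim_sum); apply: filterS Gp => f /= pf.
  have := fsum_le_total (fun i => sqr_ge0 (rnorm ((p - f) i)))
            (@l2sum_square_summable _ _ _ _ _ (p - f)) J.
  rewrite -sqr_rnorm_l2sum => /le_trans; apply.
  by rewrite lerXn2r ?nnegrE ?rnorm_ge0 ?ltW.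
have sub_ss (e : R) p : 0 < e -> G [set f | rnorm (p - f) < e] ->
    square_summable (fun i => p i - g i).
  move=> e0 Gp; have := esum_le_bound (close _ _ e0 Gp).
  by move/le_lt_trans; apply; rewrite ltry.
have gss : square_summable g.
  have [p Gp] := cG' 1 ltr01.
  rewrite (_ : g = fun i => p i + (-1) *: (p i - g i)); last first.
    by apply/funext => i; rewrite scaleN1r opprB addrC subrK.
  apply: square_summableD; first exact: l2sum_square_summable.
  by apply: square_summableZ; exact: sub_ss Gp.
have gin : in_l2sum W g by apply/asboolP.
pose q := L2Sum gin.
have closeq (e : R) p : 0 < e -> G [set f | rnorm (p - f) < e] ->
    rnorm (p - q) <= e.
  move=> e0 Gp; rewrite -(@ler_pXn2r _ 2) ?nnegrE ?rnorm_ge0 ?(ltW e0)//.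
  rewrite sqr_rnorm_l2sum; have := esum_le_bound (close _ _ e0 Gp).
  have := totalK (fun i => sqr_ge0 (rnorm ((p - q) i)))
            (@l2sum_square_summable _ _ _ _ _ (p - q)).
  by move=> ->; rewrite lee_fin; apply.
apply: (@cvgP (l2sum W) _ q); apply/cvg_ballP => e /gt0_of_realK[r r0 ->].
have r2 : 0 < r / 2 by rewrite divr_gt0.
have [p Gp] := cG' _ r2; apply: filterS (Gp) => f /= pf.
rewrite -ball_normE /= -of_rnorm ltr_of_real (splitr r).
rewrite -(subrK p q) -addrA (le_lt_trans (rnormD _ _))//.
by rewrite ler_ltD// -rnormN opprB closeq.
Qed.

HB.instance Definition _ := Uniform_isComplete.Build (l2sum W) l2sum_cauchy_cvg.

End l2sum_complete.

Section operators.
Context {R : realType} {F : scalar_kind}.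
Implicit Types X Y : hilbertType R F.

Definition bounded_operator X Y (T : X -> Y) : Prop :=
  linear T /\ exists M : R, forall x : X, rnorm (T x) <= M * rnorm x.

Definition null_space X Y (T : X -> Y) : set X := [set x | T x = 0].

(* Orthogonal projection: the unique p in U such that f - p is orthogonal
   to U. *)
Definition orth_proj X (U : closed_subspace X) (f : X) : X :=
  get [set p | subspace_set U p /\
    forall u : X, subspace_set U u -> inner (f - p) u = 0].

(* In the definitions below [get] selects the bounded operator that is
   uniquely determined by the given conditions; its value is irrelevant when
   no such operator exists. *)
Definition adjoint X Y (T : X -> Y) : Y -> X :=
  get [set S : Y -> X | bounded_operator S /\
    forall (x : X) (y : Y), inner (T x) y = inner x (S y)].

Definition inverse X Y (T : X -> Y) : Y -> X :=
  get [set S : Y -> X | [/\ bounded_operator S, cancel T S & cancel S T]].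

Definition positive_operator X (T : X -> X) : Prop :=
  [/\ bounded_operator T,
      forall x y : X, inner (T x) y = inner x (T y) &
      forall x : X, 0 <= inner (T x) x].

Definition sqrt_operator X (T : X -> X) : X -> X :=
  get [set S : X -> X | positive_operator S /\ S \o S = T].

Definition pseudo_inverse X Y (U : X -> Y) : Y -> X :=
  get [set D : Y -> X | [/\ bounded_operator D,
    range D = range (adjoint U),
    null_space D = null_space (adjoint U) &
    U \o D \o U = U]].

End operators.

Record fusion_frame (R : realType) (F : scalar_kind) (H : hilbertType R F)
    (I : choiceType) := FusionFrame {
  ff_space :> I -> closed_subspace H;
  ff_weight : I -> R;
  ff_weight_gt0 : forall i, 0 < ff_weight i;
  ff_bounds : exists A B : R, [/\ 0 < A, A <= B & forall f : H,
    ((A * rnorm f ^+ 2)%:E <=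
       \esum_(i in [set: I])
          (ff_weight i ^+ 2 * rnorm (orth_proj (ff_space i) f) ^+ 2)%:E <=
       (B * rnorm f ^+ 2)%:E)%E]
}.

Section fusion_frame_operators.
Context {R : realType} {F : scalar_kind} {H : hilbertType R F} {I : choiceType}.
Implicit Types (W V : fusion_frame H I) (O : H -> H).

(* [summability.sum] is the limit of the net of finite partial sums. *)
Definition synthesis W (f : l2sum W) : H :=
  summability.sum (fun i => of_real (ff_weight W i) *: f i).
Arguments synthesis W f : clear implicits.

Definition frame_operator W : H -> H :=
  synthesis W \o adjoint (synthesis W).

(* S_W^{-1/2} *)
Definition frame_operator_invsqrt W : H -> H :=
  sqrt_operator (inverse (frame_operator W)).

Definition operator_matrix W V O : l2sum V -> l2sum W :=
  adjoint (synthesis W) \o O \o synthesis V.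

Definition operator_matrix_tensor W V O : l2sum V -> l2sum W :=
  adjoint (synthesis W) \o frame_operator_invsqrt W \o O
    \o frame_operator_invsqrt V \o synthesis V.

End fusion_frame_operators.

Arguments synthesis {R F H I} W f.
Arguments operator_matrix {R F H I} W V O f.
Arguments operator_matrix_tensor {R F H I} W V O f.

(* Main.v *)
Require Import Defs.
From mathcomp Require Import all_boot all_order all_algebra finmap complex.
From mathcomp Require Import boolp classical_sets functions reals ereal topology.
From mathcomp Require Import normedtype sequences esum.
From mathcomp Require Import ring lra.
From mathcomp.analysis.showcase Require summability.

Set Implicit Arguments.
Unset Strict Implicit.
Unset Printing Implicit Defensive.
Import Order.TTheory GRing.Theory Num.Def Num.Theory.
Import numFieldNormedType.Exports.
Local Open Scope classical_set_scope.
Local Open Scope ring_scope.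

(** A prime denotes the adjoint and O^+ the pseudo-inverse of O.

    Both matrices have the form M = A' O B with A and B bounded and onto H:
    A = T_W and B = T_V for the plain matrix, A = S_W^(-1/2) T_W and
    B = S_V^(-1/2) T_V for the tensor one.  The candidate pseudo-inverse is
    D = B' G A for an operator G on H.  Since A is onto and B' is one-to-one,
    R(D) is the image of R(G) under B' and N(D) is the preimage of N(G) under A,
    and the same holds for M' = B' O' A.  Hence D is the pseudo-inverse of M
    exactly when R(G) = R(O'), N(G) = N(O') and O B B' G A A' O = O
    [sandwich_pseudo_inverse].

    In the tensor case A A' = B B' = 1, so G = O^+ satisfies the three
    conditions by the definition of O^+.  In the plain case A A' = S_W and
    B B' = S_V, so with G = S_V^(-1) O^+ S_W^(-1) the third condition is
    O O^+ O = O, the first one reads S_V^(-1) R(O') = R(O'), and the second one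
    says that N(O') is invariant under S_W.  As R(O) is closed it is the
    orthogonal complement of N(O'), and S_W is self-adjoint, so the second
    condition is equivalent to S_W R(O) = R(O) [null_space_invariant].

    The operators in the statement are chosen by their characteristic
    properties, so each of them has to be shown to exist.  Most of
    them are limits of sequences whose steps decay geometrically:
    - minimizing a quadratic functional on a closed subspace gives orthogonal
      projections and adjoints [riesz_closed_subspace];
    - Richardson iteration inverts coercive operators [coercive_surj];
    - a gliding hump gives the uniform boundedness principle
      [uniform_boundedness], by which the adjoint of an operator with closed
      range is bounded below on that range, so that U^+ = U' (U U')^(-1) P with
      P the projection onto R(U) [is_pseudo_inverse_exists];
    - the iteration Y := (K + Y^2) / 2 gives the square root 1 - Y of 1 - K
      when K is a self-adjoint contraction [half_fixpoint], whence S_W^(-1/2).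
    The frame bounds make the sums that define T_W converge [synthesis_cvg] and
    make S_W coercive [frame_operator_coercive].

    Analytic estimates use the real inner product Re <x, y>, which treats real
    and complex scalars alike and determines <x, y>. *)

(** * The real inner product *)

(** An identity between real parts that holds for all vectors holds between the
    scalars themselves: scaling one argument turns the difference d of the two
    sides into d times its conjugate. *)
Lemma mul_conj_eq0 (R : realType) (F : scalar_kind) (d : scalar_field R F) :
  sre (d * sconj d) = 0 -> d = 0.
Proof.
rewrite mul_conj => h; have : `|d| ^+ 2 = 0 by rewrite -[LHS]of_realK ?exprn_ge0// h rmorph0.
by move/eqP; rewrite sqrf_eq0 normr_eq0 => /eqP.
Qed.

Lemma conj_of_real (R : realType) (F : scalar_kind) (r : R) :
  sconj (of_real r) = of_real r :> scalar_field R F.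
Proof. by rewrite /sconj /of_real; case: F => //; exact: conjc_real. Qed.

Section real_inner.
Context {R : realType} {F : scalar_kind} {H : hilbertType R F}.
Implicit Types (x y z : H) (r : R).

Definition rip x y : R := sre (inner x y).

Lemma innerC x y : inner x y = sconj (inner y x).
Proof. by rewrite hermC expr0 mul1r. Qed.

Lemma ripC x y : rip x y = rip y x.
Proof. by rewrite /rip innerC re_conj. Qed.

Lemma ripDl x y z : rip (x + y) z = rip x z + rip y z.
Proof. by rewrite /rip linearDl raddfD. Qed.

Lemma ripDr x y z : rip z (x + y) = rip z x + rip z y.
Proof. by rewrite !(ripC z) ripDl. Qed.

Lemma ripZl r x y : rip (of_real r *: x) y = r * rip x y.
Proof. by rewrite /rip linearZl_LR /= reM_of_real. Qed.

Lemma ripZr r x y : rip x (of_real r *: y) = r * rip x y.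
Proof. by rewrite !(ripC x) ripZl. Qed.

Lemma ripNl x y : rip (- x) y = - rip x y.
Proof. by rewrite /rip linearNl raddfN. Qed.

Lemma ripNr x y : rip y (- x) = - rip y x.
Proof. by rewrite !(ripC y) ripNl. Qed.

Lemma ripBl x y z : rip (x - y) z = rip x z - rip y z.
Proof. by rewrite ripDl ripNl. Qed.

Lemma ripBr x y z : rip z (x - y) = rip z x - rip z y.
Proof. by rewrite ripDr ripNr. Qed.

Lemma rip0l x : rip 0 x = 0.
Proof. by rewrite -(subrr x) ripBl subrr. Qed.

Lemma rip0r x : rip x 0 = 0.
Proof. by rewrite ripC rip0l. Qed.

Lemma ripxx x : rip x x = rnorm x ^+ 2.
Proof. by rewrite /rip -sqr_normE -of_rnorm -rmorphXn re_of_real. Qed.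

Lemma rip_le x y : rip x y <= rnorm x * rnorm y.
Proof. by apply: le_trans (re_le_norm _) _; exact: norm_inner. Qed.

Lemma rip_norm x y : `|rip x y| <= rnorm x * rnorm y.
Proof. by rewrite ler_norml lerNl -ripNl rip_le andbT -(rnormN x) rip_le. Qed.

Lemma rnorm_eq0 x : rnorm x = 0 -> x = 0.
Proof. by move=> x0; apply/eqP; rewrite -normr_eq0 -of_rnorm x0 rmorph0. Qed.

Lemma rnorm_le0 x : rnorm x <= 0 -> x = 0.
Proof. by move=> x0; apply/rnorm_eq0/eqP; rewrite eq_le x0 rnorm_ge0. Qed.

Lemma rip_eq0 x : rip x x = 0 -> x = 0.
Proof. by rewrite ripxx => /eqP; rewrite sqrf_eq0 => /eqP /rnorm_eq0. Qed.

Lemma rnormZr r x : rnorm (of_real r *: x) = `|r| * rnorm x.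
Proof. by rewrite rnormZ norm_of_real re_of_real. Qed.

Lemma sqr_rnormD x y : rnorm (x + y) ^+ 2 = rnorm x ^+ 2 + 2 * rip x y + rnorm y ^+ 2.
Proof. by rewrite -!ripxx ripDl !ripDr (ripC y x); ring. Qed.

Lemma eq_ripl x y : (forall z, rip x z = rip y z) -> x = y.
Proof.
by move=> xy; apply/eqP; rewrite -subr_eq0; apply/eqP/rip_eq0; rewrite ripBl xy subrr.
Qed.

Lemma eq_innerl x y : (forall z, inner x z = inner y z) -> x = y.
Proof. by move=> xy; apply: eq_ripl => z; rewrite /rip xy. Qed.

Lemma eq_innerr x y : (forall z, inner z x = inner z y) -> x = y.
Proof. by move=> xy; apply: eq_innerl => z; rewrite innerC xy -innerC. Qed.

End real_inner.

(** * Sequences with geometrically decaying steps *)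

Lemma le0_geometric (R : realType) (a C q : R) : 0 <= q < 1 ->
  (forall n, a <= C * q ^+ n) -> a <= 0.
Proof.
move=> /andP[q0 q1] aC.
have : (fun n => C * q ^+ n) @ \oo --> C * 0.
  by apply: cvgMl_tmp; apply: cvg_expr; rewrite ger0_norm.
rewrite mulr0 => /cvgr_to_ge; apply; exact: nearW.
Qed.

Section geometric.
Context {R : realType} {F : scalar_kind} {H : hilbertType R F}.

Lemma geometric_dist (u : nat -> H) (C q : R) : 0 <= q < 1 -> 0 <= C ->
  (forall n, rnorm (u n.+1 - u n) <= C * q ^+ n) ->
  forall n m, rnorm (u (n + m)%N - u n) <= C * q ^+ n / (1 - q).
Proof.
move=> /andP[q0 q1] C0 uC n m.
have q1' : 0 < 1 - q by lra.
suff h : rnorm (u (n + m)%N - u n) <= C * q ^+ n / (1 - q) * (1 - q ^+ m).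
  apply: le_trans h _; apply: ler_piMr; last by rewrite gerBl exprn_ge0.
  by rewrite divr_ge0 ?(ltW q1')// mulr_ge0 ?exprn_ge0.
elim: m => [|m IH]; first by rewrite addn0 subrr rnorm0 expr0 subrr mulr0.
rewrite -(subrK (u (n + m)%N) (u _)) -addrA (le_trans (rnormD _ _))//.
rewrite addnS; apply: le_trans (lerD (uC _) IH) _.
rewrite exprD exprS le_eqVlt; apply/orP; left; apply/eqP; field.
by rewrite gt_eqF.
Qed.

(** The explicit rate at which the limit is approached lets identities be passed
    to the limit by [le0_geometric]. *)
Lemma geometric_limit (u : nat -> H) (C q : R) (K : set H) :
  0 <= q < 1 -> 0 <= C -> closed K -> (forall n, K (u n)) ->
  (forall n, rnorm (u n.+1 - u n) <= C * q ^+ n) ->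
  exists2 x, K x & forall n, rnorm (x - u n) <= C * q ^+ n / (1 - q).
Proof.
move=> q01 C0 Kcl Ku uC; have dist := geometric_dist q01 C0 uC.
have /andP[q0 q1] := q01; have q1' : 0 < 1 - q by lra.
have small (e : R) : 0 < e -> exists n, C * q ^+ n / (1 - q) < e.
  move=> e0; apply: contrapT => /forallNP h.
  suff : e <= 0 by rewrite leNgt e0.
  apply: (le0_geometric (C := C / (1 - q)) q01) => n.
  by rewrite leNgt mulrAC; apply/negP.
have /cauchy_cvg ucvg : cauchy (u @ \oo).
  apply: cauchy_exP => e /gt0_of_realK[r r0 ->].
  have [n hn] := small _ r0; exists (u n).
  suff : \forall k \near \oo, ball (u n) (of_real r) (u k) by [].
  exists n => // k /= nk; rewrite -ball_normE /= -of_rnorm ltr_of_real.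
  by rewrite -rnormN opprB (le_lt_trans _ hn)// -(subnKC nk).
exists (lim (u @ \oo)).
  apply: (@closed_cvg nat H \oo _ u K Kcl _ _ ucvg).
  exact: nearW.
move=> n.
have /cvgr_to_le : (fun k => rnorm (u k - u n)) @ \oo --> rnorm (lim (u @ \oo) - u n).
  by apply: rnorm_cvg; apply: cvgB => //; exact: cvg_cst.
by apply; exists n => // k /= nk; rewrite -(subnKC nk).
Qed.

End geometric.

(** * Riesz representation, coercive equations and uniform boundedness *)

Section riesz.
Context {R : realType} {F : scalar_kind} {H : hilbertType R F}.
Implicit Types (K Z : set H) (x y z : H) (r : R).

(** Subspaces over the reals: the real inner product only interacts with real
    scalars, and every complex subspace is one of these. *)
Definition real_subspace K : Prop :=
  K 0 /\ forall r x y, K x -> K y -> K (of_real r *: x + y).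

Lemma real_subspaceZ K r x : real_subspace K -> K x -> K (of_real r *: x).
Proof. by move=> [K0 Klin] Kx; rewrite -[_ *: _]addr0; exact: Klin. Qed.

Lemma real_subspaceD K x y : real_subspace K -> K x -> K y -> K (x + y).
Proof. by move=> [_ Klin] Kx Ky; rewrite -(scale1r x) -(rmorph1 of_real); exact: Klin. Qed.

Lemma real_subspaceB K x y : real_subspace K -> K x -> K y -> K (x - y).
Proof.
move=> [_ Klin] Kx Ky; rewrite addrC -scaleN1r -(rmorph1 of_real) -rmorphN.
exact: Klin.
Qed.

Lemma real_subspaceT : real_subspace setT.
Proof. by []. Qed.

(** The representative p minimizes J(u) = |u|^2 - 2 l(u) on K.  With l = Re <f, .>
    this is the orthogonal projection of f onto K, and with K the whole space it
    is the Riesz representation theorem.  A sequence with J(u_n) < inf J + 4^(-n)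
    has steps at most 2 * 2^(-n) by the parallelogram law, and the discriminant
    of t |-> J(u_n + t v) bounds Re <u_n, v> - l(v) by 2^(-n) |v|. *)
Lemma riesz_closed_subspace K (l : H -> R) (M : R) :
  closed K -> real_subspace K ->
  (forall r x y, l (of_real r *: x + y) = r * l x + l y) ->
  (forall x, `|l x| <= M * rnorm x) ->
  exists2 p, K p & forall v, K v -> rip p v = l v.
Proof.
move=> Kcl Klin llin lM; have [K0 KD] := Klin.
pose J u := rnorm u ^+ 2 - 2 * l u.
have JD u v t : J (u + of_real t *: v) =
    J u + 2 * t * (rip u v - l v) + t ^+ 2 * rnorm v ^+ 2.
  rewrite /J [u + _]addrC sqr_rnormD llin ripZl rnormZr exprMn real_normK ?num_real//.
  by rewrite (ripC v); ring.
have l0 : l 0 = 0.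
  by have := llin 1 0 0; rewrite scaler0 addr0; lra.
have Jinf : has_inf (J @` K).
  split; first by exists (J 0), 0.
  exists (- M ^+ 2) => _ [u _ <-]; rewrite /J.
  have := lM u; rewrite ler_norml => /andP[_ lu].
  have : 0 <= (rnorm u - M) ^+ 2 by exact: sqr_ge0.
  by rewrite sqrrB; lra.
pose m := inf (J @` K).
have mJ u : K u -> m <= J u.
  by move=> Ku; apply: ge_inf; [case: Jinf|exists u].
have q4 n : 0 < (1 / 4 : R) ^+ n by rewrite exprn_gt0.
have /choice[u uP] : forall n, exists u, K u /\ J u < m + (1 / 4) ^+ n.
  by move=> n; have [_ [u Ku <-] hu] := inf_adherent (q4 n) Jinf; exists u.
have q2 n : (1 / 4 : R) ^+ n = ((1 / 2) ^+ n) ^+ 2.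
  by rewrite -exprM mulnC exprM; congr (_ ^+ n); field.
have ud n : rnorm (u n.+1 - u n) <= 2 * (1 / 2) ^+ n.
  have [Ku Ju] := uP n; have [Ku' Ju'] := uP n.+1.
  rewrite -(@ler_pXn2r _ 2) ?nnegrE ?rnorm_ge0 ?mulr_ge0 ?exprn_ge0//.
  rewrite exprMn -q2.
  pose w := of_real (1 / 2) *: (u n.+1 + u n).
  have Kw : K w by apply: real_subspaceZ => //; exact: real_subspaceD.
  have hw := mJ _ Kw.
  have lw : l w = (l (u n.+1) + l (u n)) / 2.
    rewrite /w -[_ *: _]addr0 llin l0 addr0.
    have := llin 1 (u n.+1) (u n); rewrite rmorph1 scale1r => ->.
    by field.
  have nw : rnorm w ^+ 2 = (rnorm (u n.+1) ^+ 2 + 2 * rip (u n.+1) (u n) + rnorm (u n) ^+ 2) / 4.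
    by rewrite rnormZr exprMn sqr_rnormD real_normK ?num_real//; field.
  (* The parallelogram law, with w the midpoint of u_n and u_{n+1}. *)
  have e4 := exprS (1 / 4 : R) n.
  move: hw Ju Ju'; rewrite /J lw nw e4 sqr_rnormD ripNr rnormN.
  have := q4 n; set a := _ ^+ n; set b := rip _ _.
  by move=> ? ? ? ?; lra.
have q01 : 0 <= (1 / 2 : R) < 1 by apply/andP; split; lra.
have [p Kp pu] := geometric_limit q01 (ler0n _ 2) Kcl (fun n => (uP n).1) ud.
exists p => // v Kv.
have hd n : `|rip (u n) v - l v| <= (1 / 2) ^+ n * rnorm v.
  have [->|v0] := eqVneq v 0; first by rewrite rip0r l0 subrr normr0 rnorm0 mulr0.
  have nv : 0 < rnorm v.
    rewrite lt_neqAle rnorm_ge0 andbT; apply: contra v0 => /eqP.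
    by move/esym/rnorm_eq0 => ->.
  rewrite -(@ler_pXn2r _ 2) ?nnegrE ?mulr_ge0 ?exprn_ge0 ?rnorm_ge0//.
  rewrite exprMn -q2 real_normK ?num_real//.
  (* The step along v that minimizes J on the line through u_n. *)
  set d := rip (u n) v - l v.
  have [Ku Ju] := uP n.
  have Kt : K (u n + of_real (- d / rnorm v ^+ 2) *: v).
    by rewrite addrC; apply: KD.
  have := mJ _ Kt; rewrite JD -/d => h.
  have : 2 * (- d / rnorm v ^+ 2) * d + (- d / rnorm v ^+ 2) ^+ 2 * rnorm v ^+ 2 =
      - (d ^+ 2 / rnorm v ^+ 2) by field; rewrite gt_eqF.
  move=> e; rewrite -ler_pdivrMr ?exprn_gt0//.
  by move: h; rewrite -addrA e; lra.
apply/eqP; rewrite -subr_eq0 -normr_eq0 eq_le normr_ge0 andbT.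
apply: (le0_geometric (C := 5 * rnorm v) q01) => n.
rewrite (_ : _ - _ = rip (p - u n) v + (rip (u n) v - l v)); last by rewrite ripBl; ring.
apply: le_trans (ler_normD _ _) _.
have h1 := rip_norm (p - u n) v.
have h2 : rnorm (p - u n) * rnorm v <= 4 * (1 / 2) ^+ n * rnorm v.
  apply: ler_wpM2r; first exact: rnorm_ge0.
  by apply: le_trans (pu n) _; rewrite le_eqVlt; apply/orP; left; apply/eqP; field.
by have := hd n; lra.
Qed.

(** |x - t A x|^2 <= (1 - 2 t c + t^2 N^2) |x|^2 when |A x| <= N |x|; the right
    side is least for t = c / N^2.  Taking N = |M| + c ensures c <= N, so that
    the contraction factor is a square root of a nonnegative number. *)
Lemma richardson_contraction K (A : H -> H) (M c : R) :
  (forall x, rnorm (A x) <= M * rnorm x) ->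
  0 < c -> (forall x, K x -> c * rnorm x ^+ 2 <= rip (A x) x) ->
  exists t q : R, [/\ 0 < t, 0 <= q < 1 &
    forall x, K x -> rnorm (x - of_real t *: A x) <= q * rnorm x].
Proof.
move=> AM c0 Ac.
pose N := `|M| + c.
have N0 : 0 < N by rewrite ltr_wpDl.
have AN x : rnorm (A x) <= N * rnorm x.
  apply: le_trans (AM x) _; apply: ler_wpM2r; first exact: rnorm_ge0.
  by rewrite (le_trans (ler_norm M))// lerDl ltW.
pose t := c / N ^+ 2.
have t0 : 0 < t by rewrite divr_gt0 ?exprn_gt0.
pose q := Num.sqrt (1 - (c / N) ^+ 2).
have cN : 0 < c / N <= 1.
  by rewrite divr_gt0//= ler_pdivrMr// mul1r lerDr.
have cN2 : 0 < (c / N) ^+ 2 <= 1.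
  by case/andP: cN => h1 h2; rewrite exprn_gt0//= exprn_ile1// ltW.
have qq : q ^+ 2 = 1 - (c / N) ^+ 2.
  by rewrite sqr_sqrtr// subr_ge0; case/andP: cN2.
exists t, q; split=> // [|x Kx].
  rewrite sqrtr_ge0/= -(@ltr_pXn2r _ 2) ?nnegrE ?sqrtr_ge0// qq expr1n.
  by case/andP: cN2; lra.
rewrite -(@ler_pXn2r _ 2) ?nnegrE ?mulr_ge0 ?sqrtr_ge0 ?rnorm_ge0//.
rewrite exprMn qq sqr_rnormD rnormN ripNr ripZr rnormZr exprMn real_normK ?num_real//.
have h1 : t ^+ 2 * rnorm (A x) ^+ 2 <= t ^+ 2 * (N ^+ 2 * rnorm x ^+ 2).
  apply: ler_wpM2l; first exact: sqr_ge0.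
  by rewrite -exprMn ler_pXn2r ?nnegrE ?mulr_ge0 ?rnorm_ge0 ?(ltW N0).
have h2 : t * (c * rnorm x ^+ 2) <= t * rip (A x) x.
  by apply: ler_wpM2l; [exact: ltW|exact: Ac].
have e1 : t ^+ 2 * (N ^+ 2 * rnorm x ^+ 2) = (c / N) ^+ 2 * rnorm x ^+ 2.
  by rewrite /t; field; rewrite gt_eqF.
have e2 : t * (c * rnorm x ^+ 2) = (c / N) ^+ 2 * rnorm x ^+ 2.
  by rewrite /t; field; rewrite gt_eqF.
by rewrite (ripC x); lra.
Qed.

(** The solution is the limit of u_{n+1} = u_n + t (y - A u_n), whose error is
    multiplied by the contraction 1 - t A at each step. *)
Lemma coercive_surj K (A : H -> H) (M c : R) :
  closed K -> real_subspace K -> (forall x, K x -> K (A x)) ->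
  {morph A : x y / x - y} ->
  0 <= M -> (forall x, rnorm (A x) <= M * rnorm x) ->
  0 < c -> (forall x, K x -> c * rnorm x ^+ 2 <= rip (A x) x) ->
  forall y, K y -> exists2 x, K x & A x = y.
Proof.
move=> Kcl Klin KA AB M0 AM c0 Ac y Ky; have [K0 KD] := Klin.
have [t [q [t0 q01 step]]] := richardson_contraction AM c0 Ac.
have [u [u0 uE]] : exists u : nat -> H,
    u 0%N = 0 /\ forall n, u n.+1 = u n + of_real t *: (y - A (u n)).
  by exists (fix u n := if n is k.+1 then u k + of_real t *: (y - A (u k)) else 0).
have Ku n : K (u n).
  elim: n => [|n IH]; first by rewrite u0.
  rewrite uE addrC; apply: KD => //.
  by apply: real_subspaceB => //; exact: KA.
have uS n : u n.+1 - u n = of_real t *: (y - A (u n)).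
  by rewrite uE addrC addKr.
pose C := rnorm (of_real t *: (y - A 0)).
have ud n : rnorm (u n.+1 - u n) <= C * q ^+ n.
  elim: n => [|n IH]; first by rewrite uS u0 expr0 mulr1.
  have -> : u n.+2 - u n.+1 =
      (u n.+1 - u n) - of_real t *: A (u n.+1 - u n).
    rewrite (uS n.+1) {1}(uS n) -scalerBr AB; congr (_ *: _).
    by rewrite opprB addrA subrK.
  apply: le_trans (step _ _) _; first exact: real_subspaceB.
  rewrite exprS mulrCA; apply: ler_wpM2l => //.
  by case/andP: q01.
have [x Kx xu] := geometric_limit q01 (rnorm_ge0 _) Kcl Ku ud.
exists x => //; apply/eqP; rewrite eq_sym -subr_eq0; apply/eqP/rnorm_le0.
apply: (le0_geometric (C := C / t + M * (C / (1 - q))) q01) => n.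
rewrite -(subrK (A (u n)) y) -addrA -AB.
apply: le_trans (rnormD _ _) _; rewrite mulrDl; apply: lerD.
  rewrite mulrAC ler_pdivlMr// mulrC -[t in t * _]ger0_norm ?(ltW t0)//.
  by rewrite -rnormZr -uS.
apply: le_trans (AM _) _; rewrite -mulrA; apply: ler_wpM2l => //.
by rewrite -rnormN opprB mulrAC.
Qed.

(** Gliding hump.  Were Z unbounded, pick z_n in Z with |z_n| > 4^n and move from
    u_n to u_{n+1} = u_n +/- 3^(-n) z_n / |z_n|, where one of the signs gives
    |Re <u_{n+1}, z_n>| >= 3^(-n) |z_n|.  All later steps move by at most half of
    3^(-n) in total, so the limit x satisfies
    |Re <x, z_n>| >= 3^(-n) |z_n| / 2 >= (4/3)^n / 2, which is unbounded. *)
Lemma uniform_boundedness K Z : closed K -> real_subspace K -> Z `<=` K ->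
  (forall y, K y -> exists C : R, forall z, Z z -> `|rip y z| <= C) ->
  exists C : R, forall z, Z z -> rnorm z <= C.
Proof.
move=> Kcl Klin ZK ptw; apply: contrapT => /forallNP unb.
have p4 n : 0 < (4 : R) ^+ n by rewrite exprn_gt0.
have /choice[z zP] : forall n : nat, exists z, Z z /\ 4 ^+ n < rnorm z.
  move=> n; have /existsNP[z /not_implyP[Zz /negP]] := unb (4 ^+ n).
  by rewrite -ltNge; exists z.
pose h n := of_real ((1 / 3) ^+ n / rnorm (z n)) *: z n.
have z0 n : 0 < rnorm (z n) by case: (zP n) => _; exact: lt_trans.
have Kh n : K (h n) by apply: real_subspaceZ => //; apply/ZK; case: (zP n).
have q3 n : 0 <= (1 / 3 : R) ^+ n by rewrite exprn_ge0.
have [u [u0 uE]] : exists u : nat -> H, u 0%N = 0 /\ forall n, u n.+1 =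
    if (1 / 3) ^+ n * rnorm (z n) <= `|rip (u n + h n) (z n)|
    then u n + h n else u n - h n.
  by exists (fix u n := if n is k.+1 then
    (if (1 / 3) ^+ k * rnorm (z k) <= `|rip (u k + h k) (z k)|
     then u k + h k else u k - h k) else 0).
have Ku n : K (u n).
  elim: n => [|n IH]; first by rewrite u0; case: Klin.
  rewrite uE; case: ifP => _; last by apply: real_subspaceB.
  by apply: real_subspaceD.
have ud n : rnorm (u n.+1 - u n) <= 1 * (1 / 3) ^+ n.
  have hn : rnorm (h n) = (1 / 3) ^+ n.
    by rewrite rnormZr ger0_norm ?divr_ge0 ?q3 ?rnorm_ge0// divfK// gt_eqF.
  rewrite mul1r uE; case: ifP => _; rewrite addrC addKr ?rnormN.
  - by rewrite hn.
  - by rewrite hn.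
have uz n : (1 / 3) ^+ n * rnorm (z n) <= `|rip (u n.+1) (z n)|.
  rewrite uE; case: ifPn => //; rewrite -ltNge => lt1.
  rewrite leNgt; apply/negP => lt2.
  have hz : rip (h n) (z n) = (1 / 3) ^+ n * rnorm (z n).
    by rewrite ripZl ripxx expr2 mulrA divfK ?gt_eqF.
  have : rip (h n) (z n) *+ 2 = rip (u n + h n) (z n) - rip (u n - h n) (z n).
    by rewrite ripDl ripBl; ring.
  move: lt1 lt2; rewrite !ltr_norml => /andP[_ h1] /andP[h2 _].
  by rewrite hz; lra.
have q01 : 0 <= (1 / 3 : R) < 1 by apply/andP; split; lra.
have [x Kx xu] := geometric_limit q01 ler01 Kcl Ku ud.
have [C xC] := ptw _ Kx.
suff : (1 / 2 : R) <= 0 by lra.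
have r01 : 0 <= (3 / 4 : R) < 1 by apply/andP; split; lra.
apply: (le0_geometric (C := C) r01) => n.
have [Zz zn] := zP n.
have h1 := rip_norm (x - u n.+1) (z n).
have h2 : rnorm (x - u n.+1) * rnorm (z n) <= (1 / 3) ^+ n / 2 * rnorm (z n).
  apply: ler_wpM2r; first exact: rnorm_ge0.
  apply: le_trans (xu _) _; rewrite exprS le_eqVlt.
  by apply/orP; left; apply/eqP; field.
have h3 : `|rip (u n.+1) (z n)| <= `|rip x (z n)| + `|rip (x - u n.+1) (z n)|.
  rewrite (_ : rip (u n.+1) _ = rip x (z n) - rip (x - u n.+1) (z n)).
    exact: ler_normB.
  by rewrite ripBl; ring.
have h4 : (1 / 3) ^+ n * rnorm (z n) / 2 <= C.
  by have := uz n; have := xC _ Zz; lra.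
have h5 : (1 / 3) ^+ n * 4 ^+ n <= (1 / 3) ^+ n * rnorm (z n).
  by apply: ler_wpM2l; [exact: q3|exact: ltW].
have h6 : (1 / 3) ^+ n * 4 ^+ n * (3 / 4) ^+ n = 1 :> R.
  by rewrite -!exprMn (_ : _ * _ = 1) ?expr1n//; field.
have -> : 1 / 2 = (1 / 3) ^+ n * 4 ^+ n / 2 * (3 / 4) ^+ n :> R.
  by rewrite mulrAC h6.
apply: ler_wpM2r; first by rewrite exprn_ge0//; lra.
by lra.
Qed.

End riesz.

(** * Linear maps and adjoints *)

Section linear_maps.
Context {R : realType} {F : scalar_kind}.
Implicit Types X Y Z : hilbertType R F.

Lemma linear_map0 X Y (T : X -> Y) : linear T -> T 0 = 0.
Proof.
move=> Tl; have := Tl 1 0 0; rewrite !scale1r addr0 => /eqP.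
by rewrite -subr_eq0 opprD addNKr oppr_eq0 => /eqP.
Qed.

Lemma linear_mapZ X Y (T : X -> Y) a x : linear T -> T (a *: x) = a *: T x.
Proof. by move=> Tl; rewrite -[a *: x]addr0 Tl linear_map0// addr0. Qed.

Lemma linear_mapD X Y (T : X -> Y) x y : linear T -> T (x + y) = T x + T y.
Proof. by move=> Tl; have := Tl 1 x y; rewrite !scale1r. Qed.

Lemma linear_mapB X Y (T : X -> Y) x y : linear T -> T (x - y) = T x - T y.
Proof. by move=> Tl; rewrite linear_mapD// -scaleN1r linear_mapZ// scaleN1r. Qed.

Lemma bounded_gt0 X Y (T : X -> Y) : bounded_operator T ->
  exists2 M, 0 < M & forall x, rnorm (T x) <= M * rnorm x.
Proof.
move=> [_ [M TM]]; exists (`|M| + 1); first by rewrite ltr_wpDl.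
move=> x; apply: le_trans (TM x) _; apply: ler_wpM2r; first exact: rnorm_ge0.
by apply: le_trans (ler_norm M) _; rewrite lerDl.
Qed.

Lemma bounded_comp X Y Z (S : Y -> Z) (T : X -> Y) :
  bounded_operator S -> bounded_operator T -> bounded_operator (S \o T).
Proof.
move=> Sb Tb; have [M M0 SM] := bounded_gt0 Sb; have [N N0 TN] := bounded_gt0 Tb.
split; first by move=> a x y /=; rewrite Tb.1 Sb.1.
exists (M * N) => x /=; apply: le_trans (SM _) _; rewrite -mulrA.
by apply: ler_wpM2l => //; exact: ltW.
Qed.

Lemma range_real_subspace X Y (T : X -> Y) : linear T -> real_subspace (range T).
Proof.
move=> Tl; split; first by exists 0 => //; exact: linear_map0.
by move=> r _ _ [x _ <-] [y _ <-]; exists (of_real r *: x + y) => //; rewrite Tl.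
Qed.

End linear_maps.

Section adjoints.
Context {R : realType} {F : scalar_kind}.
Implicit Types X Y Z : hilbertType R F.

Definition is_adjoint X Y (T : X -> Y) (S : Y -> X) : Prop :=
  forall (x : X) (y : Y), inner (T x) y = inner x (S y).

Lemma is_adjointC X Y (T : X -> Y) (S : Y -> X) : is_adjoint T S -> is_adjoint S T.
Proof. by move=> TS x y; rewrite innerC -TS -innerC. Qed.

Lemma is_adjoint_comp X Y Z (T : X -> Y) (T' : Y -> X) (S : Y -> Z) (S' : Z -> Y) :
  is_adjoint T T' -> is_adjoint S S' -> is_adjoint (S \o T) (T' \o S').
Proof. by move=> TT' SS' x z /=; rewrite SS' TT'. Qed.

Lemma is_adjoint_rip X Y (T : X -> Y) (S : Y -> X) x y :
  is_adjoint T S -> rip (T x) y = rip x (S y).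
Proof. by move=> TS; rewrite /rip TS. Qed.

Lemma is_adjoint_linear X Y (T : X -> Y) (S : Y -> X) : is_adjoint T S -> linear T.
Proof.
move=> TS a x y; apply: eq_innerl => z.
by rewrite TS !linearDl !linearZl_LR /= !TS.
Qed.

Lemma is_adjoint_unique X Y (T : X -> Y) (S S' : Y -> X) :
  is_adjoint T S -> is_adjoint T S' -> S = S'.
Proof.
by move=> TS TS'; apply/funext => y; apply: eq_innerr => x; rewrite -TS TS'.
Qed.

(** |S y|^2 = Re <T S y, y> <= M |S y| |y|. *)
Lemma is_adjoint_bounded X Y (T : X -> Y) (S : Y -> X) :
  is_adjoint T S -> bounded_operator T -> bounded_operator S.
Proof.
move=> TS Tb; split; first exact: is_adjoint_linear (is_adjointC TS).
have [M M0 TM] := bounded_gt0 Tb; exists M => y.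
have [->|Sy0] := eqVneq (S y) 0; first by rewrite rnorm0 mulr_ge0 ?rnorm_ge0 ?ltW.
have Sy : 0 < rnorm (S y).
  rewrite lt_neqAle rnorm_ge0 andbT; apply: contra Sy0 => /eqP/esym Sy0.
  by rewrite (rnorm_eq0 Sy0).
rewrite -(ler_pM2l Sy) -expr2 -ripxx -(is_adjoint_rip _ _ TS).
apply: le_trans (rip_le _ _) _; rewrite [leRHS]mulrA [_ * M]mulrC.
by apply: ler_wpM2r => //; exact: rnorm_ge0.
Qed.

(** Evaluating the real identity at d x, for d the conjugate of
    <T x, y> - <x, S y>, gives |<T x, y> - <x, S y>|^2 = 0. *)
Lemma is_adjoint_real X Y (T : X -> Y) (S : Y -> X) : linear T ->
  (forall x y, rip (T x) y = rip x (S y)) -> is_adjoint T S.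
Proof.
move=> Tl TS x y; apply/eqP; rewrite -subr_eq0; apply/eqP/mul_conj_eq0.
set d := _ - _; have := TS (sconj d *: x) y.
rewrite linear_mapZ// /rip !linearZl_LR /= => /eqP.
by rewrite -subr_eq0 -raddfB -mulrBr mulrC => /eqP.
Qed.

Lemma adjoint_exists X Y (T : X -> Y) : bounded_operator T ->
  exists S, is_adjoint T S.
Proof.
move=> Tb; have Tl := Tb.1; have [M M0 TM] := bounded_gt0 Tb.
suff /choice[S SP] : forall y, exists s, forall x, rip (T x) y = rip x s.
  by exists S; apply: is_adjoint_real => // x y; exact: SP.
move=> y.
have [r u v|x|p _ pP] := @riesz_closed_subspace R F X setT
    (fun x => rip (T x) y) (M * rnorm y) closedT real_subspaceT.
- by rewrite Tl ripDl ripZl.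
- apply: le_trans (rip_norm _ _) _; rewrite mulrAC.
  by apply: ler_wpM2r => //; exact: rnorm_ge0.
by exists p => x; rewrite [RHS]ripC pP.
Qed.

Lemma adjointE X Y (T : X -> Y) (S : Y -> X) :
  bounded_operator T -> is_adjoint T S -> adjoint T = S.
Proof.
move=> Tb TS; apply: get_unique; first by split=> //; exact: is_adjoint_bounded Tb.
by move=> S' [_ TS']; exact: is_adjoint_unique TS' TS.
Qed.

Lemma adjointP X Y (T : X -> Y) : bounded_operator T -> is_adjoint T (adjoint T).
Proof. by move=> Tb; have [S TS] := adjoint_exists Tb; rewrite (adjointE Tb TS). Qed.

Lemma adjoint_bounded X Y (T : X -> Y) :
  bounded_operator T -> bounded_operator (adjoint T).
Proof. by move=> Tb; exact: is_adjoint_bounded (adjointP Tb) Tb. Qed.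

Lemma adjoint_surj_inj X Y (T : X -> Y) (S : Y -> X) : is_adjoint T S ->
  range T = setT -> injective S.
Proof.
move=> TS Tsurj y y' Syy'; apply: eq_innerr => z.
have : range T z by rewrite Tsurj.
by move=> [x _ <-]; rewrite !TS Syy'.
Qed.

End adjoints.

(** * Inverses and pseudo-inverses *)

Section inverses.
Context {R : realType} {F : scalar_kind} {X : hilbertType R F}.

(** Coercivity bounds S below by Cauchy-Schwarz, which gives both injectivity and
    the bound on the inverse; surjectivity is [coercive_surj]. *)
Lemma coercive_inverse (S : X -> X) (c : R) : bounded_operator S -> 0 < c ->
  (forall x, c * rnorm x ^+ 2 <= rip (S x) x) ->
  [/\ bounded_operator (inverse S), cancel S (inverse S) & cancel (inverse S) S].
Proof.
move=> Sb c0 Sc; have Sl := Sb.1.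
have lower x : c * rnorm x <= rnorm (S x).
  have [->|x0] := eqVneq (rnorm x) 0; first by rewrite mulr0 rnorm_ge0.
  have x_gt0 : 0 < rnorm x by rewrite lt_neqAle eq_sym x0 rnorm_ge0.
  rewrite -(ler_pM2r x_gt0) -mulrA -expr2.
  by apply: le_trans (Sc x) (rip_le _ _).
have Sinj x y : S x = S y -> x = y.
  move=> Sxy; apply/eqP; rewrite -subr_eq0; apply/eqP/rnorm_le0.
  rewrite -(pmulr_rle0 _ c0); apply: le_trans (lower _) _.
  by rewrite linear_mapB// Sxy subrr rnorm0.
have /choice[T ST] : forall y, exists x, S x = y.
  move=> y; have [M M0 SM] := bounded_gt0 Sb.
  suff [x _ Sx] : exists2 x, setT x & S x = y by exists x.
  apply: (coercive_surj closedT real_subspaceT _ _ (ltW M0) SM c0) => //.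
  by move=> u v; rewrite linear_mapB.
have TS x : T (S x) = x by apply: Sinj; rewrite ST.
apply: (@getI _ [set T : X -> X | [/\ bounded_operator T, cancel S T & cancel T S]] T).
split=> //; split.
  by move=> a x y; apply: Sinj; rewrite Sl !ST.
exists c^-1 => x; rewrite ler_pdivlMl//.
by apply: le_trans (lower _) _; rewrite ST.
Qed.

End inverses.

Section pseudo_inverses.
Context {R : realType} {F : scalar_kind}.
Implicit Types X Y : hilbertType R F.

Definition is_pseudo_inverse X Y (U : X -> Y) (D : Y -> X) : Prop :=
  [/\ bounded_operator D, range D = range (adjoint U),
      null_space D = null_space (adjoint U) & U \o D \o U = U].

Lemma adjoint_kernel X Y (U : X -> Y) (S : Y -> X) x :
  is_adjoint U S -> S (U x) = 0 -> U x = 0.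
Proof. by move=> US SUx; apply: rip_eq0; rewrite (is_adjoint_rip _ _ US) SUx rip0r. Qed.

Lemma range_adjoint_kernel X Y (U : X -> Y) (S : Y -> X) x :
  is_adjoint U S -> range S x -> U x = 0 -> x = 0.
Proof. by move=> US [z _ <-] Uz; exact: adjoint_kernel (is_adjointC US) Uz. Qed.

(** Together with D y in R(U'), this normal equation determines D y, so it is
    the pointwise form of the pseudo-inverse.  U D is idempotent, so y - U D y is
    killed by U D, hence by D, because R(D) = R(U') meets N(U) only in 0. *)
Lemma pseudo_inverse_residual X Y (U : X -> Y) (D : Y -> X) y :
  bounded_operator U -> is_pseudo_inverse U D -> adjoint U (y - U (D y)) = 0.
Proof.
move=> Ub [[Dl _] DR DN UDU]; have UA := adjointP Ub; have [Ul _] := Ub.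
suff : null_space (adjoint U) (y - U (D y)) by [].
rewrite -DN /null_space /= linear_mapB//.
apply: (range_adjoint_kernel UA); first by rewrite -DR -linear_mapB//; exists (y - U (D y)).
by rewrite linear_mapB//; have /= -> := congr1 (@^~ (D y)) UDU; rewrite subrr.
Qed.

Lemma least_squares_unique X Y (U : X -> Y) y d d' : bounded_operator U ->
  range (adjoint U) d -> range (adjoint U) d' ->
  adjoint U (y - U d) = 0 -> adjoint U (y - U d') = 0 -> d = d'.
Proof.
move=> Ub [z _ <-] [z' _ <-] d0 d'0; have UA := adjointP Ub.
have [Ul _] := Ub; have [Al _] := adjoint_bounded Ub.
apply/eqP; rewrite -subr_eq0; apply/eqP/(range_adjoint_kernel UA).
  by exists (z - z') => //; rewrite linear_mapB.
apply: (adjoint_kernel UA); rewrite linear_mapB//.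
have -> : U (adjoint U z) - U (adjoint U z') =
    (y - U (adjoint U z')) - (y - U (adjoint U z)).
  by rewrite opprB [RHS]addrC addrA subrK.
by rewrite (linear_mapB _ _ Al) d0 d'0 subrr.
Qed.

Lemma is_pseudo_inverse_unique X Y (U : X -> Y) (D D' : Y -> X) :
  bounded_operator U -> is_pseudo_inverse U D -> is_pseudo_inverse U D' -> D = D'.
Proof.
move=> Ub DP D'P; apply/funext => y; apply: (least_squares_unique (y := y) Ub).
- by case: DP => _ <- _ _; exists y.
- by case: D'P => _ <- _ _; exists y.
- exact: pseudo_inverse_residual DP.
- exact: pseudo_inverse_residual D'P.
Qed.

(** On R(U) the functionals Re <., z> with |S z| <= 1 are pointwise bounded, since
    |<U x, z>| = |<x, S z>| <= |x|.  By uniform boundedness these z are bounded. *)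
Lemma adjoint_bounded_below X Y (U : X -> Y) (S : Y -> X) :
  bounded_operator U -> closed (range U) -> is_adjoint U S ->
  exists2 C : R, 0 < C & forall z, range U z -> rnorm z <= C * rnorm (S z).
Proof.
move=> Ub Ucl US; have Ul := Ub.1; have Sl := is_adjoint_linear (is_adjointC US).
have Usub := range_real_subspace Ul.
have [|_ [x _ <-]|C CP] := @uniform_boundedness R F Y (range U)
    [set z | range U z /\ rnorm (S z) <= 1] Ucl Usub.
- by move=> z [].
- exists (rnorm x) => z [_ Sz]; rewrite (is_adjoint_rip _ _ US).
  by apply: le_trans (rip_norm _ _) _; rewrite ler_piMr ?rnorm_ge0.
have C0 : 0 <= C.
  apply: le_trans (rnorm_ge0 0) (CP 0 _); split; first by case: Usub.
  by rewrite linear_map0 ?rnorm0.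
exists (C + 1) => [|z Uz]; first by rewrite ltr_wpDl.
have [Sz0|Sz0] := eqVneq (rnorm (S z)) 0.
  case: Uz Sz0 => x _ <- /rnorm_eq0 /(adjoint_kernel US) ->.
  by rewrite rnorm0 mulr_ge0 ?rnorm_ge0 ?addr_ge0.
have Sz : 0 < rnorm (S z) by rewrite lt_neqAle eq_sym Sz0 rnorm_ge0.
have Sz' : `|(rnorm (S z))^-1| = (rnorm (S z))^-1.
  by rewrite ger0_norm ?invr_ge0 ?rnorm_ge0.
have := CP (of_real (rnorm (S z))^-1 *: z).
rewrite rnormZr Sz' ler_pdivrMl// mulrC => h; apply: le_trans (h _) _.
  split; first exact: real_subspaceZ.
  by rewrite linear_mapZ// rnormZr Sz' mulVf.
by apply: ler_wpM2r; rewrite ?rnorm_ge0// lerDl.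
Qed.

(** U U' is coercive on R(U), so U U' z = p can be solved there for the projection
    p of y onto R(U), and D y = U' z.  By construction D y is in R(U') and solves
    the normal equation U' (y - U D y) = 0; [least_squares_unique] then yields
    linearity and the algebraic properties without any analysis of the choice
    of z. *)
Lemma is_pseudo_inverse_exists X Y (U : X -> Y) :
  bounded_operator U -> closed (range U) -> exists D, is_pseudo_inverse U D.
Proof.
move=> Ub Ucl; have UA := adjointP Ub; have AU := is_adjointC UA.
have Ab := adjoint_bounded Ub; have [Ul _] := Ub; have [Al _] := Ab.
set A := adjoint U in UA AU Ab Al *.
have Usub := range_real_subspace Ul.
have [C C0 lower] := adjoint_bounded_below Ub Ucl UA.
have C20 : 0 < (C ^+ 2)^-1 by rewrite invr_gt0 exprn_gt0.
have UAb := bounded_comp Ub Ab; have [M M0 UAM] := bounded_gt0 UAb.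
(* Coercivity: <U U' z, z> = |U' z|^2 >= |z|^2 / C^2. *)
have solve p : range U p -> exists2 z, range U z & U (A z) = p.
  apply: (coercive_surj Ucl Usub (A := U \o A) _ _ (ltW M0) UAM C20) => //=.
  - by move=> z _; exists (A z).
  - by move=> u v; rewrite -[LHS]/((U \o A) _) linear_mapB//; exact: UAb.1.
  - move=> z Uz; rewrite (is_adjoint_rip _ _ UA) ripxx ler_pdivrMl ?exprn_gt0//.
    rewrite -exprMn ler_pXn2r ?nnegrE ?mulr_ge0 ?rnorm_ge0 ?(ltW C0)//.
    exact: lower.
have /choice[g gP] : forall y, exists z, range U z /\ A (y - U (A z)) = 0.
  move=> y.
  have [r u v|v|p Up py] := @riesz_closed_subspace R F Y (range U) (rip y) (rnorm y) Ucl Usub.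
  - by rewrite ripDr ripZr.
  - exact: rip_norm.
  have [z Uz zp] := solve p Up; exists z; split=> //.
  apply: eq_ripl => x; rewrite rip0l (is_adjoint_rip _ _ AU) zp ripBl py ?subrr//.
pose D y := A (g y).
have Dres y : A (y - U (D y)) = 0 by case: (gP y).
have DA y : range A (D y) by exists (g y).
have Dunique y d : range A d -> A (y - U d) = 0 -> D y = d.
  by move=> Ad Ay; exact: (least_squares_unique (y := y) Ub).
exists D; split.
- split.
    move=> a x y; apply: Dunique; first by exists (a *: g x + g y); rewrite ?Al.
    rewrite Ul opprD addrACA -scalerBr Al !Dres scaler0 addr0//.
  exists C => y.
  have [Dy0|Dy0] := eqVneq (rnorm (D y)) 0.
    by rewrite Dy0 mulr_ge0 ?rnorm_ge0 ?ltW.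
  have Dy : 0 < rnorm (D y) by rewrite lt_neqAle eq_sym Dy0 rnorm_ge0.
  (* |D y|^2 = Re <z, U D y> = Re <z, y> <= |z| |y| <= C |D y| |y|, z = g y. *)
  rewrite -(ler_pM2l Dy) -expr2 -ripxx [X in rip X _]/D (is_adjoint_rip _ _ AU).
  have [Ugy _] := gP y.
  have -> : rip (g y) (U (D y)) = rip (g y) y.
    apply/eqP; rewrite eq_sym -subr_eq0 -ripBr; case: Ugy => x _ <-.
    by rewrite (is_adjoint_rip _ _ UA) -/A Dres rip0r.
  apply: le_trans (rip_le _ _) _; rewrite mulrA; apply: ler_wpM2r.
    exact: rnorm_ge0.
  by rewrite mulrC; exact: lower.
- rewrite eqEsubset; split=> [_ [y _ <-]|d [w _ <-]]; first exact: DA.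
  exists (U (A w)) => //; apply: Dunique; first by exists w.
  by rewrite subrr linear_map0.
- rewrite eqEsubset; split=> y; rewrite /null_space /= => y0.
    by have := Dres y; rewrite y0 linear_map0// subr0.
  apply: Dunique; last by rewrite linear_map0// subr0.
  by exists 0 => //; rewrite linear_map0.
- apply/funext => x /=; apply/eqP; rewrite -subr_eq0 -linear_mapB//.
  apply/eqP/(adjoint_kernel UA); rewrite linear_mapB//.
  by rewrite -opprB -scaleN1r linear_mapZ// Dres scaler0.
Qed.

Lemma pseudo_inverseE X Y (U : X -> Y) (D : Y -> X) :
  bounded_operator U -> is_pseudo_inverse U D -> pseudo_inverse U = D.
Proof.
move=> Ub DP; apply: (@get_unique (Y -> X)) => // D' D'P.
exact: is_pseudo_inverse_unique D'P DP.
Qed.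

Lemma pseudo_inverseP X Y (U : X -> Y) :
  bounded_operator U -> closed (range U) -> is_pseudo_inverse U (pseudo_inverse U).
Proof.
by move=> Ub Ucl; have [D DP] := is_pseudo_inverse_exists Ub Ucl; rewrite (pseudo_inverseE Ub DP).
Qed.

End pseudo_inverses.

(** * Square roots of coercive operators *)

Section square_roots.
Context {R : realType} {F : scalar_kind} {H : hilbertType R F}.
Implicit Types (x y z : H).

Lemma real_ge0 (a : scalar_field R F) : sconj a = a -> 0 <= sre a -> 0 <= a.
Proof.
rewrite /sconj /sre; case: F a => //= -[a b] /= [/eqP] hb a0.
by move: hb; rewrite eqNr => /eqP ->; rewrite lecE /= eqxx.
Qed.

(** Iterate Y_{n+1} = (K + Y_n^2) / 2 from 0.  All Y_n are polynomials in K, so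
    they commute, and the bound |Y_n| <= q persists because
    (q + q^2) / 2 <= q.  Therefore
    Y_{n+2} - Y_{n+1} = (Y_{n+1} + Y_n) (Y_{n+1} - Y_n) / 2
    shrinks by the factor q at each step. *)
Lemma half_fixpoint (K : H -> H) (q : R) : 0 <= q < 1 ->
  is_adjoint K K -> (forall x, rnorm (K x) <= q * rnorm x) ->
  exists Y : H -> H, [/\ is_adjoint Y Y, forall x, rnorm (Y x) <= q * rnorm x &
    forall x, Y x = of_real (1 / 2) *: (K x + Y (Y x))].
Proof.
move=> q01 KK Kq; have /andP[q0 q1] := q01.
have Kl := is_adjoint_linear KK.
have [Y_ [Y0 YS]] : exists Y_ : nat -> H -> H, (forall x, Y_ 0%N x = 0) /\
    forall n x, Y_ n.+1 x = of_real (1 / 2) *: (K x + Y_ n (Y_ n x)).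
  by exists (fix Y_ n := if n is k.+1 then
    fun x => of_real (1 / 2) *: (K x + Y_ k (Y_ k x)) else fun=> 0).
have Yl n : linear (Y_ n).
  elim: n => [|n IH] a x y; first by rewrite !Y0 scaler0 addr0.
  rewrite !YS Kl !IH [a *: (_ *: _)]scalerA [a * _]mulrC -[(_ * a) *: _]scalerA -scalerDr.
  congr (_ *: _).
  by rewrite scalerDr addrACA.
have Ysym n x y : rip (Y_ n x) y = rip x (Y_ n y).
  elim: n x y => [|n IH] x y; first by rewrite !Y0 rip0l rip0r.
  by rewrite !YS ripZl ripZr ripDl ripDr (is_adjoint_rip _ _ KK) !IH.
have Yq n x : rnorm (Y_ n x) <= q * rnorm x.
  elim: n x => [|n IH] x; first by rewrite Y0 rnorm0 mulr_ge0 ?rnorm_ge0.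
  rewrite YS rnormZr ger0_norm; last lra.
  have h := rnormD (K x) (Y_ n (Y_ n x)).
  have h1 : rnorm (Y_ n (Y_ n x)) <= q * rnorm x.
    apply: le_trans (IH _) _; apply: ler_wpM2l => //.
    apply: le_trans (IH _) _; rewrite ler_piMl ?rnorm_ge0//; exact: ltW.
  by have := Kq x; lra.
have Ycomm (Z : H -> H) : linear Z -> (forall x, Z (K x) = K (Z x)) ->
    forall n x, Z (Y_ n x) = Y_ n (Z x).
  move=> Zl ZK; elim=> [|n IH] x; first by rewrite !Y0 linear_map0.
  by rewrite !YS linear_mapZ// linear_mapD// ZK !IH.
have YC n m x : Y_ n (Y_ m x) = Y_ m (Y_ n x).
  by apply: (Ycomm (Y_ n)) => // {}x; rewrite -(Ycomm K).
have Yd x n : rnorm (Y_ n.+1 x - Y_ n x) <= q * rnorm x * q ^+ n.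
  elim: n => [|n IH].
    by rewrite Y0 subr0 expr0 mulr1.
  set d := Y_ n.+1 x - Y_ n x in IH.
  have -> : Y_ n.+2 x - Y_ n.+1 x = of_real (1 / 2) *: (Y_ n.+1 d + Y_ n d).
    rewrite (YS n.+1) [X in _ - X]YS -scalerBr; congr (_ *: _).
    rewrite /d !(linear_mapB _ _ (Yl _)) (YC n n.+1) opprD addrACA subrr add0r.
    by rewrite addrA subrK.
  rewrite rnormZr ger0_norm; last lra.
  have h := rnormD (Y_ n.+1 d) (Y_ n d).
  have h1 : q * rnorm d <= q * rnorm x * q ^+ n.+1.
    by rewrite exprS mulrCA; apply: ler_wpM2l.
  by have := Yq n d; have := Yq n.+1 d; lra.
have /choice[Y YP] : forall x, exists y, forall n,
    rnorm (y - Y_ n x) <= q * rnorm x * q ^+ n / (1 - q).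
  move=> x; have [//|y _ yP] := geometric_limit q01 _ closedT (fun=> I) (Yd x).
    by rewrite mulr_ge0 ?rnorm_ge0.
  by exists y.
have Ylim x : exists2 C, 0 <= C & forall n, rnorm (Y x - Y_ n x) <= C * q ^+ n.
  exists (q * rnorm x / (1 - q)) => [|n].
    by rewrite divr_ge0 ?mulr_ge0 ?rnorm_ge0// subr_ge0 ltW.
  by rewrite mulrAC; exact: YP.
have lin : linear Y.
  move=> a x y; apply/eqP; rewrite -subr_eq0; apply/eqP/rnorm_le0.
  have [C1 _ h1] := Ylim (a *: x + y).
  have [C2 _ h2] := Ylim x; have [C3 _ h3] := Ylim y.
  apply: (le0_geometric (C := C1 + sre `|a| * C2 + C3) q01) => n.
  have -> : Y (a *: x + y) - (a *: Y x + Y y) = (Y (a *: x + y) - Y_ n (a *: x + y))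
      + (- (a *: (Y x - Y_ n x)) + - (Y y - Y_ n y)).
    rewrite Yl scalerBr -opprD -addrA; congr (_ + _).
    by rewrite [X in _ + - X]addrACA -[X in _ + - (_ + X)]opprD opprB addKr.
  rewrite !mulrDl -[leRHS]addrA; apply: le_trans (rnormD _ _) _.
  apply: lerD (h1 n) _; apply: le_trans (rnormD _ _) _.
  rewrite !rnormN rnormZ -mulrA; apply: lerD (h3 n); apply: ler_wpM2l (h2 n).
  by rewrite -(raddf0 (@sre R F)) ler_re.
have bnd x : rnorm (Y x) <= q * rnorm x.
  have [C _ h] := Ylim x.
  rewrite -subr_le0; apply: (le0_geometric (C := C) q01) => n.
  rewrite lerBlDr -(subrK (Y_ n x) (Y x)).
  by apply: le_trans (rnormD _ _) _; rewrite lerD.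
exists Y; split=> // [|x].
  apply: is_adjoint_real => // x y; apply/eqP; rewrite -subr_eq0 -normr_eq0.
  rewrite eq_le normr_ge0 andbT.
  have [C1 _ h1] := Ylim x; have [C2 _ h2] := Ylim y.
  apply: (le0_geometric (C := C1 * rnorm y + rnorm x * C2) q01) => n.
  have -> : rip (Y x) y - rip x (Y y) = rip (Y x - Y_ n x) y - rip x (Y y - Y_ n y).
    by rewrite ripBl ripBr Ysym; ring.
  apply: le_trans (ler_normB _ _) _.
  rewrite [leRHS]mulrDl [X in _ <= X + _]mulrAC -[X in _ <= _ + X]mulrA.
  apply: lerD; apply: le_trans (rip_norm _ _) _.
    by apply: ler_wpM2r (h1 n); exact: rnorm_ge0.
  by apply: ler_wpM2l (h2 n); exact: rnorm_ge0.
apply/eqP; rewrite -subr_eq0; apply/eqP/rnorm_le0.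
have [C1 C10 h1] := Ylim x; have [C2 C20 h2] := Ylim (Y x).
apply: (le0_geometric (C := C1 + (C1 + C2)) q01) => n.
have -> : Y x - of_real (1 / 2) *: (K x + Y (Y x)) =
    (Y x - Y_ n.+1 x) + of_real (1 / 2) *:
      (- (Y_ n (Y x - Y_ n x)) + - (Y (Y x) - Y_ n (Y x))).
  rewrite (linear_mapB _ _ (Yl n)) !opprB YS -addrA; congr (_ + _).
  rewrite -!scalerN -scalerDr; congr (_ *: _).
  by rewrite [X in _ = _ + X]addrA subrK !opprD addrA subrK.
rewrite [leRHS]mulrDl; apply: le_trans (rnormD _ _) _.
have qn : 0 <= q ^+ n by rewrite exprn_ge0.
apply: lerD.
  apply: le_trans (h1 n.+1) _; apply: ler_wpM2l => //.
  by rewrite exprS ler_piMl// ltW.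
rewrite rnormZr ger0_norm; last lra.
have h := rnormD (- Y_ n (Y x - Y_ n x)) (- (Y (Y x) - Y_ n (Y x))).
rewrite !rnormN in h.
have h3 := Yq n (Y x - Y_ n x).
have h4 : q * rnorm (Y x - Y_ n x) <= C1 * q ^+ n.
  by apply: le_trans (h1 n); rewrite ler_piMl ?rnorm_ge0// ltW.
have h5 := mulr_ge0 C10 qn; have h6 := mulr_ge0 C20 qn.
by have := h2 n; lra.
Qed.

(** For a small t > 0 the operator K = 1 - t T is a contraction, and the fixed
    point 2 Y = K + Y^2 means (1 - Y)^2 = 1 - K = t T; the square root of T is
    (1 - Y) / sqrt t, positive because |Y| <= 1. *)
Lemma coercive_sqrt (T : H -> H) (a : R) : bounded_operator T -> is_adjoint T T ->
  0 < a -> (forall x, a * rnorm x ^+ 2 <= rip (T x) x) ->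
  positive_operator (sqrt_operator T) /\ sqrt_operator T \o sqrt_operator T = T.
Proof.
move=> Tb TT a0 Ta; have Tl := Tb.1.
apply: (@getPex _ [set S : H -> H | positive_operator S /\ S \o S = T]).
have [M M0 TM] := bounded_gt0 Tb.
have [t [q [t0 q01 Tq]]] := richardson_contraction TM a0 (fun x (_ : setT x) => Ta x).
have /andP[q0 q1] := q01.
have [|x|Y [YY Yq YE]] := @half_fixpoint (fun x => x - of_real t *: T x) q q01.
- apply: is_adjoint_real => [b x y|x y].
    by rewrite Tl scalerDr scalerBr opprD addrACA !scalerA mulrC.
  by rewrite ripBl ripBr ripZl ripZr (is_adjoint_rip _ _ TT).
- exact: Tq.
have Yl := is_adjoint_linear YY.
pose s : R := (Num.sqrt t)^-1.
have s0 : 0 <= s by rewrite invr_ge0 sqrtr_ge0.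
have Y2 x : x - Y x - Y (x - Y x) = of_real t *: T x.
  have YY2 : Y x + Y x = (x - of_real t *: T x) + Y (Y x).
    rewrite {1 2}YE -scalerDl -rmorphD (_ : 1 / 2 + 1 / 2 = 1) ?rmorph1 ?scale1r//.
    by field.
  rewrite (linear_mapB _ _ Yl) opprB [Y (Y x) - _]addrC addrA.
  rewrite -[x - _ - _]addrA -opprD YY2.
  by rewrite opprD addrA subrK opprB addrC subrK.
pose B x := of_real s *: (x - Y x).
have BB : is_adjoint B B.
  apply: is_adjoint_real => [b x y|x y].
    rewrite /B Yl opprD addrACA -scalerBr scalerDr !scalerA.
    by rewrite [b * _]mulrC.
  by rewrite ripZl ripZr ripBl ripBr (is_adjoint_rip _ _ YY).
exists B; split; last first.
  apply/funext => x; rewrite /B /= [Y (_ *: _)]linear_mapZ// -scalerBr Y2.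
  rewrite !scalerA -!rmorphM /= /s -invfM -expr2 sqr_sqrtr ?(ltW t0)// mulVf ?gt_eqF//.
  by rewrite rmorph1 scale1r.
split=> //.
  split; first exact: is_adjoint_linear BB.
  exists (s * 2) => x; rewrite rnormZr ger0_norm// -mulrA; apply: ler_wpM2l => //.
  apply: le_trans (rnormD _ _) _; rewrite rnormN.
  have := Yq x; have : q * rnorm x <= rnorm x by rewrite ler_piMl ?rnorm_ge0// ltW.
  lra.
move=> x; apply: real_ge0; first by rewrite -innerC -BB.
rewrite -/(rip (B x) x) ripZl; apply: mulr_ge0 => //.
rewrite ripBl ripxx.
have h := rip_le (Y x) x.
have h1 : rnorm (Y x) * rnorm x <= rnorm x ^+ 2.
  rewrite expr2; apply: ler_wpM2r; first exact: rnorm_ge0.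
  by apply: le_trans (Yq x) _; rewrite ler_piMl ?rnorm_ge0// ltW.
lra.
Qed.

End square_roots.

(** * Synthesis and analysis operators of a fusion frame *)

Section orthogonal_projections.
Context {R : realType} {F : scalar_kind} {H : hilbertType R F}.
Implicit Types (U : closed_subspace H) (f g : H).

Lemma closed_subspace_real U : real_subspace (subspace_set U).
Proof. by split=> [|r x y Ux Uy]; [exact: subspace0|exact: subspaceP]. Qed.

Lemma orth_projP U f : subspace_set U (orth_proj U f) /\
  forall u : H, subspace_set U u -> inner (f - orth_proj U f) u = 0.
Proof.
have [r u v|v|p Up pf] := @riesz_closed_subspace R F H (subspace_set U) (rip f) (rnorm f)
    (@subspace_closed _ _ _ U) (closed_subspace_real U).
- by rewrite ripDr ripZr.
- exact: rip_norm.
apply: (@getI _ [set p | subspace_set U p /\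
    forall u : H, subspace_set U u -> inner (f - p) u = 0] p).
split=> // u Uu; apply: mul_conj_eq0; set d := inner _ _.
have Udu : subspace_set U (d *: u).
  by rewrite -[d *: u]addr0; apply: subspaceP => //; exact: subspace0.
have : rip (f - p) (d *: u) = 0 by rewrite ripBl pf ?subrr.
by rewrite /rip linearZr_LR /= mulrC.
Qed.

Lemma inner_orth_proj U f u : subspace_set U u -> inner u (orth_proj U f) = inner u f.
Proof.
move=> Uu; have [_ /(_ _ Uu) h] := orth_projP U f.
have : inner u (f - orth_proj U f) = 0 by rewrite innerC h rmorph0.
by rewrite linearBr => /eqP; rewrite subr_eq0 => /eqP.
Qed.

Lemma inner_cvg (T : Type) (G : set_system T) (u : T -> H) (l g : H) : Filter G ->
  u @ G --> l -> (fun t => inner (u t) g : scalar_field R F) @ G --> inner l g.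
Proof.
move=> FG /cvgrPdist_lt ul; apply/cvgrPdist_lt => e /gt0_of_realK[r r0 ->].
have g1 : 0 < rnorm g + 1 by rewrite ltr_wpDl ?rnorm_ge0.
have e0 : 0 < of_real (r / (rnorm g + 1)) :> scalar_field R F.
  by rewrite -(rmorph0 of_real) ltr_of_real divr_gt0.
apply: filterS (ul _ e0) => t; rewrite -of_rnorm ltr_of_real ltr_pdivlMr// => h.
rewrite -linearBl -(@of_realK _ _ `|_|)// ltr_of_real.
apply: le_lt_trans (norm_inner _ _) _; apply: le_lt_trans h.
by apply: ler_wpM2l; rewrite ?rnorm_ge0// lerDl.
Qed.

End orthogonal_projections.

Section frames.
Context {R : realType} {F : scalar_kind} {H : hilbertType R F} {I : choiceType}.
Variable W : fusion_frame H I.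
Implicit Types (f : l2sum W) (g : H).

Definition analysis_coord g (i : I) : H := of_real (ff_weight W i) *: orth_proj (W i) g.

Lemma analysis_coord_esum g :
  (\esum_(i in [set: I]) (rnorm (analysis_coord g i) ^+ 2)%:E =
   \esum_(i in [set: I]) (ff_weight W i ^+ 2 * rnorm (orth_proj (W i) g) ^+ 2)%:E)%E.
Proof.
apply: eq_esum => i _; congr (_%:E).
by rewrite /analysis_coord rnormZr exprMn real_normK ?num_real.
Qed.

Lemma analysis_in g : in_l2sum W (analysis_coord g).
Proof.
apply/asboolP; split=> [i|].
  rewrite /analysis_coord -[_ *: _]addr0; apply: subspaceP; last exact: subspace0.
  by case: (orth_projP (W i) g).
have [A [B [_ _ /(_ g)/andP[_ hB]]]] := ff_bounds W.
by rewrite /square_summable /finite_total analysis_coord_esum (le_lt_trans hB)// ltry.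
Qed.

(** The explicit formula for the adjoint of the synthesis operator. *)
Definition analysis g : l2sum W := L2Sum (analysis_in g).

Lemma analysis_bounds : exists A B : R, [/\ 0 < A, 0 < B & forall g,
  A * rnorm g ^+ 2 <= rnorm (analysis g) ^+ 2 <= B * rnorm g ^+ 2].
Proof.
have [A [B [A0 AB h]]] := ff_bounds W; exists A, B; split=> [//||g].
  exact: lt_le_trans AB.
rewrite sqr_rnorm_l2sum -!lee_fin -totalK; last 2 first.
- by move=> i; exact: sqr_ge0.
- exact: l2sum_square_summable.
by have := h g; rewrite -analysis_coord_esum.
Qed.

Lemma inner_analysis_coord f g i :
  inner (f i) (analysis g i) = inner (of_real (ff_weight W i) *: f i) g.
Proof.
rewrite /= /analysis_coord linearZr_LR linearZl_LR /= conj_of_real.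
by rewrite inner_orth_proj//; exact: l2sum_in.
Qed.

(** For y the finite sum, |y|^2 is the sum of the Re <f_i, a_i> with a = T_W' y.
    Splitting each term as (B |f_i|^2 + |a_i|^2 / B) / 2 and using
    sum |a_i|^2 <= B |y|^2, half of |y|^2 is absorbed on the left. *)
Lemma synthesis_fsum_bound : exists2 B : R, 0 < B & forall f (J : {fset I}),
  rnorm (\sum_(i <- J) of_real (ff_weight W i) *: f i) ^+ 2 <=
    B * \sum_(i <- J) rnorm (f i) ^+ 2.
Proof.
have [A [B [A0 B0 h]]] := analysis_bounds; exists B => // f J.
set y := \sum_(i <- J) _.
have e : rnorm y ^+ 2 = \sum_(i <- J) rip (f i) (analysis y i).
  rewrite -ripxx /rip {1}/y linear_sumlz raddf_sum /=.
  by apply: eq_bigr => i _; rewrite inner_analysis_coord.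
have hJ : \sum_(i <- J) rnorm (analysis y i) ^+ 2 <= B * rnorm y ^+ 2.
  have /andP[_] := h y; apply: le_trans.
  rewrite sqr_rnorm_l2sum; apply: fsum_le_total.
  - by move=> i; exact: sqr_ge0.
  - exact: l2sum_square_summable.
have : \sum_(i <- J) rip (f i) (analysis y i) <=
    \sum_(i <- J) (B / 2 * rnorm (f i) ^+ 2 + (2 * B)^-1 * rnorm (analysis y i) ^+ 2).
  apply: ler_sum => i _; apply: le_trans (rip_le _ _) _.
  set u := rnorm _; set v := rnorm _.
  rewrite -subr_ge0 (_ : _ - _ = (2 * B)^-1 * (B * u - v) ^+ 2).
    by rewrite mulr_ge0 ?sqr_ge0// invr_ge0 mulr_ge0// ltW.
  by field; rewrite gt_eqF.
rewrite -e big_split /= -!mulr_sumr => h1.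
have h2 : (2 * B)^-1 * \sum_(i <- J) rnorm (analysis y i) ^+ 2 <= rnorm y ^+ 2 / 2.
  rewrite [leRHS](_ : _ = (2 * B)^-1 * (B * rnorm y ^+ 2)); last by field; rewrite gt_eqF.
  by apply: ler_wpM2l => //; rewrite invr_ge0 mulr_ge0// ltW.
by lra.
Qed.

Lemma synthesis_cvg f :
  summability.partial_sum (fun i => of_real (ff_weight W i) *: f i)
    @ summability.totally --> synthesis W f.
Proof.
have [B B0 hB] := synthesis_fsum_bound.
suff : cvg (summability.partial_sum (fun i => of_real (ff_weight W i) *: f i)
    @ summability.totally) by [].
apply: cauchy_cvg; apply: cauchy_exP => e /gt0_of_realK[r r0 ->].
have r20 : 0 < r ^+ 2 / (2 * B) by rewrite divr_gt0 ?exprn_gt0 ?mulr_gt0.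
have [A hA] := tail_near (fun i => sqr_ge0 (rnorm (f i))) (l2sum_square_summable f) r20.
set x := fun i : I => of_real (ff_weight W i) *: f i.
exists (\sum_(i <- A) x i).
apply: (@near_totally _ _ A) => J AJ /=.
rewrite partial_sumE -ball_normE /= -of_rnorm ltr_of_real.
rewrite -[X in _ - X](_ : \sum_(i <- A) x i + \sum_(i <- (J `\` A)%fset) x i = _).
  rewrite opprD addNKr rnormN -(@ltr_pXn2r _ 2) ?nnegrE ?rnorm_ge0 ?(ltW r0)//.
  apply: le_lt_trans (hB _ _) _.
  apply: (@le_lt_trans _ _ (B * (r ^+ 2 / (2 * B)))).
    by apply: ler_wpM2l; [exact: ltW|exact: hA].
  rewrite (_ : B * _ = r ^+ 2 / 2); last by field; rewrite gt_eqF.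
  by have := exprn_gt0 2 r0; lra.
rewrite [RHS](big_fsetID _ (mem A))/=; congr (_ + _); apply: eq_fbigl => i.
  rewrite !inE/=.
  by have [/(fsubsetP AJ)->|_] := boolP (i \in A); rewrite ?andbF.
by rewrite !inE/= andbC.
Qed.

Lemma synthesis_analysis : is_adjoint (synthesis W) analysis.
Proof.
move=> f g; symmetry; apply: l2_inner_eq.
rewrite (_ : summability.partial_sum _ = fun J => inner
  (summability.partial_sum (fun i => of_real (ff_weight W i) *: f i) J) g).
  by apply: inner_cvg; exact: synthesis_cvg.
apply/funext => J; rewrite !partial_sumE linear_sumlz.
by apply: eq_bigr => i _; exact: inner_analysis_coord.
Qed.

Lemma analysis_bounded : bounded_operator analysis.
Proof.
split; first exact: is_adjoint_linear (is_adjointC synthesis_analysis).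
have [A [B [_ B0 h]]] := analysis_bounds; exists (Num.sqrt B) => g.
rewrite -(@ler_pXn2r _ 2) ?nnegrE ?mulr_ge0 ?sqrtr_ge0 ?rnorm_ge0//.
by rewrite exprMn sqr_sqrtr ?(ltW B0)//; case/andP: (h g).
Qed.

Lemma synthesis_bounded : bounded_operator (synthesis W).
Proof. exact: is_adjoint_bounded (is_adjointC synthesis_analysis) analysis_bounded. Qed.

Lemma adjoint_synthesis : adjoint (synthesis W) = analysis.
Proof. exact: adjointE synthesis_bounded synthesis_analysis. Qed.

Lemma frame_operatorE : frame_operator W = synthesis W \o analysis.
Proof. by rewrite /frame_operator adjoint_synthesis. Qed.

Lemma frame_operator_bounded : bounded_operator (frame_operator W).
Proof.
by rewrite frame_operatorE; apply: bounded_comp synthesis_bounded analysis_bounded.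
Qed.

Lemma frame_operator_sym : is_adjoint (frame_operator W) (frame_operator W).
Proof.
rewrite frame_operatorE; apply: is_adjoint_comp synthesis_analysis.
exact: is_adjointC synthesis_analysis.
Qed.

Lemma frame_operator_coercive : exists2 A : R, 0 < A &
  forall g, A * rnorm g ^+ 2 <= rip (frame_operator W g) g.
Proof.
have [A [B [A0 B0 h]]] := analysis_bounds; exists A => // g.
rewrite frame_operatorE /= (is_adjoint_rip _ _ synthesis_analysis) ripxx.
by case/andP: (h g).
Qed.

Lemma frame_operator_inverse : [/\ bounded_operator (inverse (frame_operator W)),
  cancel (frame_operator W) (inverse (frame_operator W)) &
  cancel (inverse (frame_operator W)) (frame_operator W)].
Proof.
have [A A0 h] := frame_operator_coercive.
exact: coercive_inverse frame_operator_bounded A0 h.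
Qed.

Lemma frame_operator_inverse_sym :
  is_adjoint (inverse (frame_operator W)) (inverse (frame_operator W)).
Proof.
have [_ SK KS] := frame_operator_inverse => x y.
by rewrite -{1}(KS y) -frame_operator_sym KS.
Qed.

Lemma frame_operator_invsqrtP :
  positive_operator (frame_operator_invsqrt W) /\
  frame_operator_invsqrt W \o frame_operator_invsqrt W = inverse (frame_operator W).
Proof.
have [A A0 h] := frame_operator_coercive.
have [Kb SK KS] := frame_operator_inverse.
have [M M0 SM] := bounded_gt0 frame_operator_bounded.
have c0 : 0 < A / M ^+ 2 by rewrite divr_gt0 ?exprn_gt0.
apply: coercive_sqrt Kb frame_operator_inverse_sym c0 _ => x.
have := h (inverse (frame_operator W) x); rewrite KS ripC; apply: le_trans.
rewrite mulrAC ler_pdivrMr ?exprn_gt0// -mulrA; apply: ler_wpM2l; first exact: ltW.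
rewrite mulrC -exprMn ler_pXn2r ?nnegrE ?mulr_ge0 ?rnorm_ge0 ?(ltW M0)//.
by rewrite -{1}(KS x).
Qed.

(** From B^2 = S^(-1) both B^2 S and S B^2 are the identity; so x = B (B (S x)),
    and B S B x = B (S B^2) (B (S x)) = x. *)
Lemma frame_operator_invsqrtK x :
  frame_operator_invsqrt W (frame_operator W (frame_operator_invsqrt W x)) = x.
Proof.
have [_ SK KS] := frame_operator_inverse; have [_ BB] := frame_operator_invsqrtP.
set S := frame_operator W in SK KS BB *; set B := frame_operator_invsqrt W in BB *.
have BBE y : B (B y) = inverse S y by rewrite -BB.
have -> : x = B (B (S x)) by rewrite BBE SK.
by rewrite [B (B (B _))]BBE KS.
Qed.

End frames.

(** * Pseudo-inverses of operator matrices *)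

Section sandwiches.
Context {R : realType} {F : scalar_kind}.
Variables (X Y H : hilbertType R F).
Variables (A : X -> H) (A' : H -> X) (B : Y -> H) (B' : H -> Y).
Hypotheses (Ab : bounded_operator A) (AA' : is_adjoint A A') (Asurj : range A = setT).
Hypotheses (Bb : bounded_operator B) (BB' : is_adjoint B B') (Bsurj : range B = setT).

Lemma range_sandwich (G : H -> H) : range (B' \o G \o A) = B' @` range G.
Proof.
rewrite eqEsubset; split=> [_ [x _ <-]|_ [_ [h _ <-] <-]].
  by exists (G (A x)) => //; exists (A x).
have : range A h by rewrite Asurj.
by move=> [x _ <-]; exists x.
Qed.

Lemma null_space_sandwich (G : H -> H) : null_space (B' \o G \o A) = A @^-1` null_space G.
Proof.
have B'0 : B' 0 = 0 by apply: linear_map0; exact: is_adjoint_linear (is_adjointC BB').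
rewrite eqEsubset; split=> x; rewrite /null_space /=; last by move=> ->.
by move=> B'x; apply: (adjoint_surj_inj BB' Bsurj); rewrite B'x.
Qed.

(** The outer factors can be cancelled: ranges are images under the one-to-one
    map B', null spaces are preimages under the onto map A, and in M D M = M,
    for M = A' O B and D = B' G A, the factor A' is one-to-one and B is onto. *)
Lemma sandwich_pseudo_inverse (O G : H -> H) : bounded_operator O -> bounded_operator G ->
  is_pseudo_inverse (A' \o O \o B) (B' \o G \o A) <->
  [/\ range G = range (adjoint O), null_space G = null_space (adjoint O) &
      forall h, O (B (B' (G (A (A' (O h)))))) = O h].
Proof.
move=> Ob Gb.
have A'b := is_adjoint_bounded AA' Ab; have B'b := is_adjoint_bounded BB' Bb.
have A'inj := adjoint_surj_inj AA' Asurj; have B'inj := adjoint_surj_inj BB' Bsurj.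
have adjE : adjoint (A' \o O \o B) = B' \o adjoint O \o A.
  apply: adjointE; first exact: bounded_comp (bounded_comp A'b Ob) Bb.
  apply: is_adjoint_comp BB' _; apply: is_adjoint_comp (adjointP Ob) _.
  exact: is_adjointC.
rewrite /is_pseudo_inverse adjE !range_sandwich !null_space_sandwich.
split=> [[_ Req Neq comp]|[-> -> comp]].
- split.
  + rewrite eqEsubset; split=> d Gd.
      have : (B' @` range (adjoint O)) (B' d) by rewrite -Req; exists d.
      by move=> [d' ? /B'inj <-].
    have : (B' @` range G) (B' d) by rewrite Req; exists d.
    by move=> [d' ? /B'inj <-].
  + rewrite eqEsubset; split=> h; have : range A h by rewrite Asurj.
      by move=> [x _ <-]; rewrite -[_ (A x)]/((A @^-1` _) x) Neq.
    by move=> [x _ <-]; rewrite -[_ (A x)]/((A @^-1` _) x) -Neq.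
  + move=> h; have : range B h by rewrite Bsurj.
    by move=> [y _ <-]; apply: A'inj; exact: (congr1 (@^~ y) comp).
- split=> //; first exact: bounded_comp (bounded_comp B'b Gb) Ab.
  by apply/funext => y /=; rewrite comp.
Qed.

End sandwiches.

Section invariant_ranges.
Context {R : realType} {F : scalar_kind} {H : hilbertType R F}.
Variables (O : H -> H) (Ob : bounded_operator O) (Ocl : closed (range O)).
Variables (S K : H -> H) (SK : cancel S K) (KS : cancel K S).

Lemma image_cancel_id (P : set H) : K @` P = P <-> S @` P = P.
Proof.
split=> PP; rewrite -{1}PP eqEsubset; split.
- by move=> _ [_ [x Px <-] <-]; rewrite KS.
- by move=> x Px; exists (K x); [exists x|rewrite KS].
- by move=> _ [_ [x Px <-] <-]; rewrite SK.
- by move=> x Px; exists (S x); [exists x|rewrite SK].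
Qed.

(** R(O) is the orthogonal complement of N(O'): y - O O^+ y lies in N(O'), so
    if y is orthogonal to N(O'), it is orthogonal to itself. *)
Lemma closed_rangeP y : range O y <-> forall z, adjoint O z = 0 -> rip y z = 0.
Proof.
have OA := adjointP Ob; split=> [[x _ <-] z Oz|y_orth].
  by rewrite (is_adjoint_rip _ _ OA) Oz rip0r.
have res := pseudo_inverse_residual y Ob (pseudo_inverseP Ob Ocl).
exists (pseudo_inverse O y) => //; apply/esym/eqP; rewrite -subr_eq0; apply/eqP/rip_eq0.
by rewrite ripBl y_orth// (is_adjoint_rip _ _ OA) res rip0r subrr.
Qed.

Hypotheses (SS : is_adjoint S S) (KKadj : is_adjoint K K).

(** Orthogonal complements turn invariance of N(O') under K = S^(-1) into
    invariance of R(O) under S, because S and K are self-adjoint. *)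
Lemma null_space_invariant :
  (forall y, adjoint O (K y) = 0 <-> adjoint O y = 0) <-> S @` range O = range O.
Proof.
have OA := adjointP Ob.
have nullP y : adjoint O y = 0 <-> forall v, range O v -> rip y v = 0.
  split=> [Oy _ [x _ <-]|h]; first by rewrite ripC (is_adjoint_rip _ _ OA) Oy rip0r.
  apply: rip_eq0; rewrite (is_adjoint_rip _ _ (is_adjointC OA)).
  by apply: h; exists (adjoint O y).
split=> [h|SR y].
  rewrite eqEsubset; split=> [_ [y /closed_rangeP Oy <-]|y /closed_rangeP Oy].
    apply/closed_rangeP => z Oz; rewrite (is_adjoint_rip _ _ SS); apply: Oy.
    by apply/h; rewrite SK.
  exists (K y); last exact: KS.
  apply/closed_rangeP => z Oz; rewrite (is_adjoint_rip _ _ KKadj); apply: Oy.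
  exact/h.
have KR : K @` range O = range O by exact/image_cancel_id.
split=> /nullP Oy; apply/nullP => v Ov.
  have : (S @` range O) (S v) by exists v.
  rewrite SR => /Oy; rewrite (is_adjoint_rip _ _ KKadj) SK//.
have : (K @` range O) (K v) by exists v.
by rewrite KR => /Oy; rewrite -(is_adjoint_rip _ _ KKadj).
Qed.

End invariant_ranges.

Section frame_surjectivity.
Context {R : realType} {F : scalar_kind} {H : hilbertType R F} {I : choiceType}.
Variable W : fusion_frame H I.

Lemma synthesis_surj : range (synthesis W) = setT.
Proof.
have [_ _ KS] := frame_operator_inverse W; rewrite eqEsubset; split=> // h _.
by exists (analysis W (inverse (frame_operator W) h)) => //; rewrite -{2}(KS h) frame_operatorE.
Qed.

(** Synthesis operator of the Parseval frame attached to W: composed with its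
    adjoint it gives S^(-1/2) S S^(-1/2) = 1. *)
Definition parseval_synthesis := frame_operator_invsqrt W \o synthesis W.
Definition parseval_analysis := adjoint (synthesis W) \o frame_operator_invsqrt W.

Lemma parseval_synthesisK : cancel parseval_analysis parseval_synthesis.
Proof. exact: frame_operator_invsqrtK. Qed.

Lemma parseval_synthesis_surj : range parseval_synthesis = setT.
Proof.
by rewrite eqEsubset; split=> // h _; exists (parseval_analysis h); rewrite ?parseval_synthesisK.
Qed.

Lemma parseval_synthesis_bounded : bounded_operator parseval_synthesis.
Proof.
have [[Bb _ _] _] := frame_operator_invsqrtP W.
exact: bounded_comp Bb (synthesis_bounded W).
Qed.

Lemma parseval_synthesis_analysis : is_adjoint parseval_synthesis parseval_analysis.
Proof.
have [[_ BB _] _] := frame_operator_invsqrtP W.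
exact: is_adjoint_comp (adjointP (synthesis_bounded W)) BB.
Qed.

End frame_surjectivity.

Theorem theorem4p7 (R : realType) (F : scalar_kind) (H : hilbertType R F)
    (I : choiceType) (W V : fusion_frame H I) (O : H -> H)
    (O_bounded : bounded_operator O) (O_closed_range : closed (range O)) :
  (closed (range (operator_matrix W V O)) ->
    (pseudo_inverse (operator_matrix W V O) =
       operator_matrix V W
         (inverse (frame_operator V) \o pseudo_inverse O
            \o inverse (frame_operator W))
     <->
     frame_operator V @` range (adjoint O) = range (adjoint O) /\
     frame_operator W @` range O = range O))
  /\
  (closed (range (operator_matrix_tensor W V O)) ->
    pseudo_inverse (operator_matrix_tensor W V O) =
      operator_matrix_tensor V W (pseudo_inverse O)).
Proof.
have OP := pseudo_inverseP O_bounded O_closed_range.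
have [Pb Prange Pnull OPO] := OP.
have OPOx h : O (pseudo_inverse O (O h)) = O h by exact: (congr1 (@^~ h) OPO).
have Wb := synthesis_bounded W; have Vb := synthesis_bounded V.
split=> [Mcl|_]; last first.
  have Mb : bounded_operator (operator_matrix_tensor W V O).
    have LWb := is_adjoint_bounded (parseval_synthesis_analysis (W := W))
      (parseval_synthesis_bounded W).
    apply: (bounded_comp (bounded_comp LWb O_bounded) (parseval_synthesis_bounded V)).
  apply: pseudo_inverseE => //.
  apply/(sandwich_pseudo_inverse (parseval_synthesis_bounded W)
    (parseval_synthesis_analysis (W := W)) (parseval_synthesis_surj W)
    (parseval_synthesis_bounded V) (parseval_synthesis_analysis (W := V))
    (parseval_synthesis_surj V) O_bounded Pb).
  by split=> // h; rewrite !parseval_synthesisK.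
have Mb : bounded_operator (operator_matrix W V O).
  by apply: bounded_comp Vb; apply: bounded_comp O_bounded; exact: adjoint_bounded.
have [KWb SKW KSW] := frame_operator_inverse W.
have [KVb SKV KSV] := frame_operator_inverse V.
set KW := inverse (frame_operator W) in KWb SKW KSW *.
set KV := inverse (frame_operator V) in KVb SKV KSV *.
pose G := KV \o pseudo_inverse O \o KW.
have Gb : bounded_operator G by apply: bounded_comp KWb; exact: bounded_comp.
apply: (@iff_trans _ (is_pseudo_inverse (operator_matrix W V O) (operator_matrix V W G))).
  split=> [<-|]; [exact: pseudo_inverseP|exact: pseudo_inverseE].
apply: iff_trans (sandwich_pseudo_inverse Wb (adjointP Wb) (synthesis_surj W)
  Vb (adjointP Vb) (synthesis_surj V) O_bounded Gb) _.
have Grange : range G = KV @` range (adjoint O).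
  rewrite -Prange eqEsubset; split=> [_ [h _ <-]|_ [_ [h _ <-] <-]].
    by exists (pseudo_inverse O (KW h)) => //; exists (KW h).
  by exists (frame_operator W h) => //; rewrite /G /= SKW.
have Gnull y : null_space G y <-> adjoint O (KW y) = 0.
  have : null_space (pseudo_inverse O) (KW y) <-> adjoint O (KW y) = 0 by rewrite Pnull.
  apply: iff_trans; rewrite /null_space /G /=; split=> [|->]; last first.
    exact: linear_map0 KVb.1.
  by move/(congr1 (frame_operator V)); rewrite KSV linear_map0//; case: (frame_operator_bounded V).
have Gnull' : null_space G = null_space (adjoint O) <->
    frame_operator W @` range O = range O.
  apply: iff_trans (null_space_invariant O_bounded O_closed_range SKW KSW
    (frame_operator_sym W) (frame_operator_inverse_sym W)).
  split=> [E y|E]; first by rewrite -Gnull E.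
  by rewrite eqEsubset; split=> y; [move/Gnull/E|move/E/Gnull].
rewrite Grange; split=> [[/(image_cancel_id SKV KSV) ? /Gnull' ? _] //|[VR WR]].
split; [exact/(image_cancel_id SKV KSV)|exact/Gnull'|move=> h].
have S_of U g : synthesis U (adjoint (synthesis U) g) = frame_operator U g by [].
by rewrite !S_of /G /= SKW KSV OPOx.
Qed.
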